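(* Let $X$ be a proper, geodesically complete $\mathrm{CAT}(0)$ space of $\dim X = n$, and let $F \colon X \to \mathbb{R}^n$ be a Busemann $(n,\delta)$-strainer map with $100n\delta < 1$. Then $F$ is a $2\sqrt{n}$-bi-Lipschitz homeomorphism.
   Context: A metric space is proper if every closed bounded subset is compact. A geodesic metric space is geodesically complete if every geodesic can be extended to a local geodesic defined on $\mathbb{R}$. $\dim$ is the covering (topological) dimension. A map $f$ of metric spaces is $c$-bi-Lipschitz if $d(f(x_1),f(x_2)) \le c\, d(x_1,x_2)$ and $d(x_1,x_2) \le c\, d(f(x_1),f(x_2))$ for all $x_1,x_2$. The ideal boundary $\partial_{\infty}X$ of a complete $\mathrm{CAT}(0)$ space $X$ is the set of classes of geodesic rays modulo being asymptotic (at bounded distance); $\gamma(\infty)$ is the class of a ray $\gamma$. For $p\in X$, $\xi\in\partial_\infty X$ there is a unique ray $p\xi$ from $p$ in the class $\xi$; $\angle_p(\xi,\eta)$ is the angle at $p$ between $p\xi$ and $p\eta$, and $\angle(\xi,\eta) := \sup_{p\in X}\angle_p(\xi,\eta)$. The Busemann function along a ray $\gamma$ is $b_\gamma(x):=\lim_{t\to\infty}(d_X(x,\gamma(t))-t)$. Let $\delta\in(0,\infty)$. Points $\xi,\eta\in\partial_\infty X$ are opposite $\delta$-spherical points if $\angle(\xi,\zeta)+\angle(\zeta,\eta)<\pi+\delta$ for every $\zeta\in\partial_\infty X$. An $m$-tuple $(\xi_1,\dots,\xi_m)$ in $\partial_\infty X$ is an $(m,\delta)$-strainer at infinity if there is another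 $m$-tuple $(\eta_1,\dots,\eta_m)$ in $\partial_\infty X$ such that (1) $\xi_j$ and $\eta_j$ are opposite $\delta$-spherical points for all $j$; (2) $\angle(\xi_j,\xi_k)$, $\angle(\eta_j,\eta_k)$ and $\angle(\xi_j,\eta_k)$ are smaller than $\pi/2+\delta$ for all distinct $j,k$. For rays $\gamma_1,\dots,\gamma_m$ in $X$, the map $F=(b_{\gamma_1},\dots,b_{\gamma_m})\colon X\to\mathbb{R}^m$ is a Busemann $(m,\delta)$-strainer map if $(\gamma_1(\infty),\dots,\gamma_m(\infty))$ is an $(m,\delta)$-strainer at infinity. *)

(* Defs.v *)
From HB Require Import structures.
From mathcomp Require Import all_boot all_order all_algebra.
From mathcomp Require Import all_classical all_reals all_analysis.
From mathcomp Require Import ring.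

Set Implicit Arguments.
Unset Strict Implicit.
Unset Printing Implicit Defensive.

Import Order.TTheory GRing.Theory Num.Theory.
Import numFieldNormedType.Exports.

Local Open Scope classical_set_scope.
Local Open Scope card_scope.
Local Open Scope ring_scope.

(* An alias of 'rV[R]_n, because 'rV[R]_n itself carries the sup norm. *)
Definition euclidean (R : realType) (n : nat) := 'rV[R]_n.

Section EuclideanMetric.
Context {R : realType} {n : nat}.
Implicit Types (x y z : 'rV[R]_n) (a b : 'I_n -> R).

Definition euclidean_dist x y : R :=
  Num.sqrt (\sum_i (x ord0 i - y ord0 i) ^+ 2).

Let sum_sqr_ge0 a : 0 <= \sum_i a i ^+ 2.
Proof. by apply: sumr_ge0 => i _; exact: sqr_ge0. Qed.

Let cauchy_schwarz a b :
  (\sum_i a i * b i) ^+ 2 <= (\sum_i a i ^+ 2) * (\sum_i b i ^+ 2).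
Proof.
set A := \sum_i a i ^+ 2; set B := \sum_i b i ^+ 2; set C := \sum_i a i * b i.
have [B0|B_neq0] := eqVneq B 0.
  have b0 i : b i = 0.
    have /psumr_eq0P : forall i, true -> 0 <= b i ^+ 2.
      by move=> j _; exact: sqr_ge0.
    by move=> /(_ B0 i isT)/eqP; rewrite sqrf_eq0 => /eqP.
  by rewrite /C big1 ?expr0n/= ?B0 ?mulr0// => i _; rewrite b0 mulr0.
have B_gt0 : 0 < B by rewrite lt_def B_neq0 sum_sqr_ge0.
have : 0 <= \sum_i (B * a i - C * b i) ^+ 2 by exact: sum_sqr_ge0.
have -> : \sum_i (B * a i - C * b i) ^+ 2 = B * (A * B - C ^+ 2).
  have sqrE i : (B * a i - C * b i) ^+ 2 =
      B ^+ 2 * a i ^+ 2 - 2 * B * C * (a i * b i) + C ^+ 2 * b i ^+ 2 by ring.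
  under eq_bigr do rewrite sqrE.
  by rewrite big_split sumrB/= -!mulr_sumr -/A -/B -/C; ring.
by rewrite pmulr_rge0// subr_ge0.
Qed.

Let minkowski a b : Num.sqrt (\sum_i (a i + b i) ^+ 2) <=
  Num.sqrt (\sum_i a i ^+ 2) + Num.sqrt (\sum_i b i ^+ 2).
Proof.
set A := \sum_i a i ^+ 2; set B := \sum_i b i ^+ 2.
have ? : 0 <= Num.sqrt A + Num.sqrt B by rewrite addr_ge0// sqrtr_ge0.
rewrite -(@ler_pXn2r _ 2)// ?nnegrE ?sqrtr_ge0// sqr_sqrtr ?sum_sqr_ge0//.
rewrite sqrrD !sqr_sqrtr ?sum_sqr_ge0//.
have -> : \sum_i (a i + b i) ^+ 2 = A + (\sum_i a i * b i) *+ 2 + B.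
  by rewrite -sumrMnl -!big_split/=; apply: eq_bigr => i _; rewrite sqrrD.
rewrite lerD2r lerD2l lerMn2r/= -sqrtrM ?sum_sqr_ge0//.
by rewrite (le_trans (ler_norm _))// -sqrtr_sqr ler_wsqrtr.
Qed.

Lemma euclidean_distxx x : euclidean_dist x x = 0.
Proof.
by rewrite /euclidean_dist big1 ?sqrtr0// => i _; rewrite subrr expr0n.
Qed.

Lemma euclidean_dist_positivity x y : euclidean_dist x y = 0 -> x = y.
Proof.
move=> /eqP; rewrite sqrtr_eq0 => xy.
have /psumr_eq0P : forall i, true -> 0 <= (x ord0 i - y ord0 i) ^+ 2.
  by move=> i _; exact: sqr_ge0.
have xy0 : \sum_i (x ord0 i - y ord0 i) ^+ 2 = 0.
  by apply/eqP; rewrite eq_le xy sum_sqr_ge0.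
move=> /(_ xy0) xyi; apply/rowP => i.
by apply/eqP; rewrite -subr_eq0 -sqrf_eq0; apply/eqP/xyi.
Qed.

Lemma euclidean_dist_sym x y : euclidean_dist x y = euclidean_dist y x.
Proof.
by congr Num.sqrt; apply: eq_bigr => i _; rewrite -sqrrN opprB.
Qed.

Lemma euclidean_dist_triangle y x z :
  euclidean_dist x z <= euclidean_dist x y + euclidean_dist y z.
Proof.
rewrite (le_trans _ (minkowski _ _))// /euclidean_dist.
by apply/ler_wsqrtr/ler_sum => i _; rewrite subrKA.
Qed.

HB.instance Definition _ := Choice.copy (euclidean R n) 'rV[R]_n.
HB.instance Definition _ := @isMetric.Build R (euclidean R n) euclidean_dist
  euclidean_distxx euclidean_dist_positivity euclidean_dist_sym
  euclidean_dist_triangle.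

End EuclideanMetric.

Section MetricSpaces.
Context {R : realType}.

Definition proper_space (X : metricType R) :=
  forall A : set X, closed A ->
    (exists M : R, forall x y, A x -> A y -> mdist x y <= M) -> compact A.

Definition bilipschitz {X Y : metricType R} (c : R) (f : X -> Y) :=
  forall x1 x2, mdist (f x1) (f x2) <= c * mdist x1 x2 /\
                mdist x1 x2 <= c * mdist (f x1) (f x2).

Definition homeomorphism {X Y : topologicalType} (f : X -> Y) :=
  continuous f /\
  exists g : Y -> X, [/\ continuous g, cancel f g & cancel g f].

Definition open_cover {X : topologicalType} (U : set (set X)) :=
  U `<=` open /\ \bigcup_(u in U) u = setT.

(* dim X < k: every open cover has an open refinement in which each point
   lies in at most k members; dim X < 0 holds only for the empty space. *)
Definition covering_dim_lt (X : topologicalType) (k : nat) :=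
  forall U : set (set X), open_cover U ->
    exists V : set (set X),
      [/\ open_cover V,
          forall v, V v -> exists2 u, U u & v `<=` u
        & forall x, [set v | V v /\ v x] #<= `I_k].

Definition covering_dim (X : topologicalType) (n : nat) :=
  covering_dim_lt X n.+1 /\ ~ covering_dim_lt X n.

(* Geodesics have unit speed and are total functions on R of which only the
   restriction to the parameter interval I matters. *)
Definition geodesic_on {X : metricType R} (I : set R) (c : R -> X) :=
  forall s t, I s -> I t -> mdist (c s) (c t) = `|s - t|.

Definition geodesic_from_to {X : metricType R} (p q : X) (c : R -> X) :=
  [/\ geodesic_on `[0, mdist p q] c, c 0 = p & c (mdist p q) = q].

Definition geodesic_space (X : metricType R) :=
  forall p q : X, exists c, geodesic_from_to p q c.

Definition local_geodesic {X : metricType R} (c : R -> X) :=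
  forall t, exists2 e : R, 0 < e & geodesic_on (ball t e) c.

(* One-point intervals are excluded, so that a one-point space is
   geodesically complete. *)
Definition geodesically_complete (X : metricType R) :=
  forall (I : set R) (c : R -> X), is_interval I ->
    (exists a b, [/\ I a, I b & a < b]) -> geodesic_on I c ->
    exists c' : R -> X, local_geodesic c' /\ forall t, I t -> c' t = c t.

Definition geodesic_triangle {X : metricType R}
    (v : 'I_3 -> X) (c : 'I_3 -> R -> X) :=
  forall i, geodesic_from_to (v i) (v (ordS i)) (c i).

(* (w, cw) is a comparison triangle for (v, c) in the Euclidean plane; since
   sides have unit speed, cw i s is the comparison point of c i s. *)
Definition CAT0 (X : metricType R) :=
  geodesic_space X /\
  forall (v : 'I_3 -> X) (c : 'I_3 -> R -> X)
         (w : 'I_3 -> euclidean R 2) (cw : 'I_3 -> R -> euclidean R 2),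
    geodesic_triangle v c -> geodesic_triangle w cw ->
    (forall i, mdist (w i) (w (ordS i)) = mdist (v i) (v (ordS i))) ->
    forall i j s t,
      0 <= s <= mdist (v i) (v (ordS i)) ->
      0 <= t <= mdist (v j) (v (ordS j)) ->
      mdist (c i s) (c j t) <= mdist (cw i s) (cw j t).

End MetricSpaces.

Section IdealBoundary.
Context {R : realType} {X : metricType R}.
Implicit Types (p x y : X) (c : R -> X) (xi eta zeta : set (R -> X)).

(* By the Euclidean law of cosines. *)
Definition comparison_angle p x y : R :=
  acos ((mdist p x ^+ 2 + mdist p y ^+ 2 - mdist x y ^+ 2)
        / (2 * mdist p x * mdist p y)).

(* The Alexandrov angle at c1 0 = c2 0; the limit exists in a CAT(0) space. *)
Definition angle_between c1 c2 : R :=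
  lim (comparison_angle (c1 0) (c1 st.1) (c2 st.2)
         @[st --> filter_prod (0 : R)^'+ (0 : R)^'+]).

Definition geodesic_ray c := geodesic_on `[0, +oo[ c.

Definition asymptotic c1 c2 :=
  exists M : R, forall t, 0 <= t -> mdist (c1 t) (c2 t) <= M.

(* c(oo), the class of the ray c *)
Definition endpoint c : set (R -> X) :=
  [set c' | geodesic_ray c' /\ asymptotic c c'].

Definition ideal_boundary : set (set (R -> X)) :=
  [set endpoint c | c in geodesic_ray].

(* In a complete CAT(0) space, the ray from p in the class xi, unique on
   [0, +oo[; cst p is a default value. *)
Definition ray_from p xi : R -> X := xget (cst p) [set c | xi c /\ c 0 = p].

Definition angle_at p xi eta : R :=
  angle_between (ray_from p xi) (ray_from p eta).

Definition angle xi eta : R := sup [set angle_at p xi eta | p in [set: X]].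

Definition busemann c x : R := lim (mdist x (c t) - t @[t --> +oo]).

Definition opposite_spherical (delta : R) xi eta :=
  forall zeta, ideal_boundary zeta ->
    angle xi zeta + angle zeta eta < pi + delta.

Definition strainer_at_infinity (m : nat) (delta : R)
    (xi : 'I_m -> set (R -> X)) :=
  (forall j, ideal_boundary (xi j)) /\
  exists eta : 'I_m -> set (R -> X),
    [/\ forall j, ideal_boundary (eta j),
        forall j, opposite_spherical delta (xi j) (eta j)
      & forall j k, j != k ->
          [/\ angle (xi j) (xi k) < pi / 2 + delta,
              angle (eta j) (eta k) < pi / 2 + delta
            & angle (xi j) (eta k) < pi / 2 + delta]].

Definition busemann_strainer_map (m : nat) (delta : R)
    (F : X -> euclidean R m) :=
  exists gamma : 'I_m -> R -> X,
    [/\ forall j, geodesic_ray (gamma j),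
        forall x, F x = \row_j busemann (gamma j) x
      & strainer_at_infinity delta (fun j => endpoint (gamma j))].

End IdealBoundary.

(* Main.v *)
Require Import Defs.
From HB Require Import structures.
From mathcomp Require Import all_boot all_order all_algebra all_fingroup.
From mathcomp Require Import zify ring lra.

(** Write b_j for the Busemann function of the j-th ray, xi_j for the end of
    that ray and eta_j for its opposite point.

    Angles at a point of X are at most the angles at infinity, and every ray
    extends backwards to a line.  From this the strainer conditions descend to
    every point p: the directions from p to xi_j and eta_j make an angle of at
    least pi - delta (strainer_antipodal), and the directions belonging to
    different indices are orthogonal up to 2 * delta (strainer_cos_orth).  As
    the slope of a Busemann function is minus the cosine of an angle, moving p
    along the ray to xi_j or to eta_j changes b_j at speed nearly 1 and the
    other coordinates at speed at most 2 * delta.  These flows are 1-Lipschitz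
    in p, since rays with the same end do not diverge.  Their composition
    moves p by at most the sum of the |t_j| and changes F by the vector t up to
    a relative error 2 * n * delta < 1 / 50 (strainer_flows_busemann).

    Consequently F is onto, and from any x each value v is attained at distance
    at most 2 * |F x - v|_1 (strainer_surjective).  Since |.|_1 is at most
    sqrt n times the Euclidean norm, this is the lower Lipschitz bound as soon
    as F is injective; the upper one holds because each b_j is 1-Lipschitz.

    Injectivity is where the dimension enters.  If F x = F y with x different
    from y, the coordinates are almost constant on the geodesic from x to y
    (strainer_segment).  Applying the flows to this geodesic gives a Lipschitz
    cube of dimension n + 1 in X, on which the n coordinates and the distance
    from x keep opposite faces apart.  By Lebesgue's covering argument, in the
    form of cube_dimension and based on Sperner's lemma for a cube, a space
    containing such a cube has covering dimension at least n + 1. *)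

Set Implicit Arguments.
Unset Strict Implicit.
Unset Printing Implicit Defensive.

(** * Sperner's lemma on a cubical grid *)

Lemma involution_even (T : finType) (f : T -> T) (S : {set T}) :
  (forall x, x \in S -> [/\ f x \in S, f (f x) = x & f x != x]) ->
  ~~ odd #|S|.
Proof.
have [m] := ubnP #|S|; elim: m S => // m IH S /ltnSE leSm fS.
have [->|[x xS]] := set_0Vmem S; first by rewrite cards0.
have [fxS ffx fxx] := fS _ xS.
have fx' : f x \in S :\ x by rewrite !inE fxx.
have cardS : #|S| = (#|S :\ x :\ f x|).+2 by rewrite (cardsD1 x S) xS (cardsD1 (f x)) fx'.
rewrite cardS /= negbK; apply: IH; first by lia.
move=> y; rewrite !inE => /and3P[yfx yx yS]; have [fyS ffy fyy] := fS _ yS.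
rewrite fyS fyy ffy; split => //; rewrite andbT; apply/andP; split.
  by apply: contraNneq yx => e; rewrite -ffy e ffx.
by apply: contraNneq yfx => e; rewrite -ffy e.
Qed.

Lemma card_ord_below (M m : nat) : m <= M.+1 -> #|[set c : 'I_M.+1 | c < m]| = m.
Proof.
move=> mM; rewrite -[RHS](card_ord m).
have -> : [set c : 'I_M.+1 | c < m] = (widen_ord mM) @: [set: 'I_m].
  apply/setP => c; rewrite inE; apply/idP/imsetP => [cm|[x _ ->]]; last exact: (ltn_ord x).
  by exists (Ordinal cm) => //; apply: val_inj.
by rewrite card_imset ?cardsT// => x y /(congr1 val)/= e; apply: val_inj.
Qed.

(** The combinatorial core of Sperner's lemma, for a map g from the d + 1
    vertices of a simplex to the colours 0..d; a vertex j is a door if the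
    d other vertices still show all of 0..d-1.  If g shows all d + 1 colours
    then the only door is the vertex of colour d.  Otherwise a door j forces
    the other vertices to show each of 0..d-1 exactly once, so the colour of
    j is repeated at exactly one other vertex, and these two are the doors. *)
Lemma doors_parity (I : finType) (M d : nat) (g : I -> 'I_M.+1) (A : {set I}) :
  #|A| = d.+1 -> d <= M -> (forall i, i \in A -> g i <= d) ->
  let C m : {set 'I_M.+1} := [set c : 'I_M.+1 | c < m] in
  odd #|[set j in A | C d \subset g @: (A :\ j)]| = (C d.+1 \subset g @: A).
Proof.
move=> cardA dM gA C.
have cardC m : m <= M.+1 -> #|C m| = m by exact: card_ord_below.
set D := [set j in A | _].
have doorinj j : j \in D -> {in A :\ j &, injective g} /\ g @: (A :\ j) = C d.
  rewrite inE => /andP[jA sub].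
  have cAj : #|A :\ j| = d by move: cardA; rewrite (cardsD1 j) jA; lia.
  have e : #|g @: (A :\ j)| = d.
    apply/eqP; rewrite eqn_leq -{1}cAj leq_imset_card /=.
    by rewrite -{1}(cardC d) ?subset_leq_card//; lia.
  split; first by apply/imset_injP; rewrite e cAj.
  by apply/esym/eqP; rewrite eqEcard sub e cardC//; lia.
have [rb|nrb] := boolP (C d.+1 \subset g @: A).
  have cgA : #|g @: A| = #|A|.
    apply/eqP; rewrite eqn_leq leq_imset_card /= cardA -{1}(cardC d.+1) ?subset_leq_card//; lia.
  have ginj : {in A &, injective g} by apply/imset_injP; rewrite cgA.
  have /imsetP[j jA gj] : (Ordinal (dM : d < M.+1)) \in g @: A.
    by apply: (subsetP rb); rewrite inE /=.
  suff -> : D = [set j] by rewrite cards1.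
  apply/setP => i; rewrite !inE; apply/andP/eqP => [[iA sub]|->].
    apply/eqP/negPn/negP => ij.
    have iD : i \in D by rewrite inE iA.
    have [_ e] := doorinj _ iD.
    have : g j \in g @: (A :\ i) by apply: imset_f; rewrite !inE eq_sym ij.
    by rewrite e inE -gj /= ltnn.
  split=> //; apply/subsetP => c cd.
  have /imsetP[l lA cl] : c \in g @: A.
    by apply: (subsetP rb); move: cd; rewrite !inE => /ltnW.
  apply/imsetP; exists l => //; rewrite !inE lA andbT.
  by apply: contraTneq cd => lj; rewrite inE cl lj -gj /= ltnn.
have [->|[j jD]] := set_0Vmem D; first by rewrite cards0.
have [ginj gim] := doorinj _ jD.
have jA : j \in A by move: jD; rewrite inE => /andP[].
have gjd : g j < d.
  rewrite ltn_neqAle gA// andbT; apply: contraNneq nrb => gjd.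
  apply/subsetP => c; rewrite inE ltnS leq_eqVlt => /orP[/eqP cd|cd].
    by apply/imsetP; exists j => //; apply: val_inj; rewrite /= gjd.
  have : c \in g @: (A :\ j) by rewrite gim !inE.
  by move=> /imsetP[i]; rewrite !inE => /andP[_ iA] ->; apply: imset_f.
have /imsetP[i iAj gij] : g j \in g @: (A :\ j) by rewrite gim !inE.
have := iAj; rewrite !inE => /andP[ij iA].
suff -> : D = [set j; i] by rewrite cards2 eq_sym ij.
apply/setP => l; rewrite in_set2; apply/idP/idP => [lD|/orP[]/eqP-> //]; last first.
  rewrite inE iA /= -gim; apply/subsetP => c /imsetP[m].
  rewrite !inE => /andP[mj mA] ->; have [->|mi] := eqVneq m i.
    by rewrite -gij; apply: imset_f; rewrite !inE eq_sym ij.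
  by apply: imset_f; rewrite !inE mi.
apply/negPn/negP; rewrite negb_or => /andP[lj li].
have [linj lim] := doorinj _ lD.
have := linj j i; rewrite !inE eq_sym lj (eq_sym i) li jA iA => /(_ isT isT gij) ji.
by rewrite ji eqxx in ij.
Qed.

(** Kuhn's triangulation of the grid {0..k}^N.  A top simplex is a corner z
    together with a permutation r: starting from z, the coordinate a is
    increased at step r a.  Lower-dimensional simplices are encoded in the
    same type: a d-simplex lives in the face where all coordinates of index
    at least d equal k, and its permutation fixes these indices.  With this
    encoding the facet of a simplex lying in the face x_e = k is, up to the
    cyclic shift of the steps, literally a simplex of dimension one less,
    so that the induction on the dimension does not change types. *)
Section CubicalSperner.
Variables (N k : nat) (col : {ffun 'I_N -> nat} -> nat).
Hypothesis k_gt0 : 0 < k.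
Hypothesis colN : forall v, col v <= N.
Hypothesis col0 : forall (v : {ffun 'I_N -> nat}) (a : 'I_N), v a = 0 -> col v != a.
Hypothesis colk : forall (v : {ffun 'I_N -> nat}) (a : 'I_N), v a = k -> col v <= a.

Notation corner := {ffun 'I_N -> 'I_k.+1}.
Notation cell := (corner * 'S_N)%type.

Definition kuhn_vertex (s : cell) (j : nat) : {ffun 'I_N -> nat} :=
  [ffun a => s.1 a + (s.2 a < j)].

Definition kuhn_simplex (d : nat) (s : cell) :=
  [forall a : 'I_N, if a < d then (s.1 a < k) else (s.1 a == k :> nat) && (s.2 a == a)].

Let C m : {set 'I_N.+1} := [set c : 'I_N.+1 | c < m].
Let scol (s : cell) (j : 'I_N.+1) : 'I_N.+1 := inord (col (kuhn_vertex s j)).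
Let verts d : {set 'I_N.+1} := [set j : 'I_N.+1 | j <= d].

Let scolE s j : scol s j = col (kuhn_vertex s j) :> nat.
Proof. by rewrite /scol inordK// ltnS. Qed.

Definition rainbow d s := C d.+1 \subset scol s @: verts d.
Definition door d (s : cell) (j : 'I_N.+1) := C d \subset scol s @: (verts d :\ j).

Lemma rainbowP d s : d <= N -> reflect
  (forall c, c <= d -> exists2 j, j <= d & col (kuhn_vertex s j) = c)
  (rainbow d s).
Proof.
move=> dN; apply: (iffP subsetP) => [H c cd|H c].
  have cN : c < N.+1 by lia.
  have : Ordinal cN \in C d.+1 by rewrite inE /= ltnS.
  move=> /H/imsetP[j]; rewrite inE => jd /(congr1 val)/= e.
  by exists j => //; rewrite e -scolE.
rewrite inE ltnS => /H[j jd e]; apply/imsetP.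
have jN : j < N.+1 by lia.
by exists (Ordinal jN); [rewrite inE|apply: val_inj; rewrite /= scolE e].
Qed.

Lemma doorP d s (j : 'I_N.+1) : d <= N -> reflect
  (forall c, c < d -> exists i, [/\ i <= d, i != j & col (kuhn_vertex s i) = c])
  (door d s j).
Proof.
move=> dN; apply: (iffP subsetP) => [H c cd|H c].
  have cN : c < N.+1 by lia.
  have : Ordinal cN \in C d by rewrite inE.
  move=> /H/imsetP[i]; rewrite !inE => /andP[ij id] /(congr1 val)/= e.
  by exists i; split => //; rewrite e -scolE.
rewrite inE => /H[i [id ij e]]; apply/imsetP.
have iN : i < N.+1 by lia.
by exists (Ordinal iN); [rewrite !inE id andbT|apply: val_inj; rewrite /= scolE e].
Qed.

Lemma kuhn_simplexP d (s : cell) : reflect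
  ((forall a : 'I_N, a < d -> s.1 a < k) /\
   (forall a : 'I_N, d <= a -> s.1 a = k :> nat /\ s.2 a = a))
  (kuhn_simplex d s).
Proof.
apply: (iffP forallP) => [H|[H1 H2] a].
  split=> a ad; have := H a; first by rewrite ad.
  by rewrite ltnNge ad /= => /andP[/eqP -> /eqP].
have [ad|ad] := ltnP a d; first exact: H1.
by have [-> ->] := H2 a ad; rewrite !eqxx.
Qed.

Lemma simplex_perm_lt d (s : cell) a : kuhn_simplex d s -> ((s.2 a : nat) < d) = (a < d).
Proof.
move=> /kuhn_simplexP[_ H].
have [ad|ad] := leqP d a; first by have [_ ->] := H _ ad; lia.
apply/negPn/negP; rewrite -leqNgt => dsa.
by have [_ /perm_inj e] := H _ dsa; rewrite e in dsa; lia.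
Qed.

(** This is where the boundary condition on the faces x_a = k enters: a
    d-simplex lies in the face x_d = k. *)
Lemma simplex_color d s i : d <= N -> kuhn_simplex d s -> i <= d ->
  col (kuhn_vertex s i) <= d.
Proof.
move=> dN /kuhn_simplexP[_ H] id; have [dN'|] := ltnP d N; last first.
  by move=> Nd; have := colN (kuhn_vertex s i); lia.
have [e1 e2] := H (Ordinal dN') (leqnn _).
by apply: (colk (a := Ordinal dN')); rewrite ffunE e1 e2 /=; lia.
Qed.

Lemma odd_doors d s : d <= N -> kuhn_simplex d s ->
  odd #|[set j in verts d | door d s j]| = rainbow d s.
Proof.
move=> dN sd; apply: doors_parity => //.
  exact: (@card_ord_below N d.+1).
by move=> i; rewrite inE scolE => /simplex_color; apply.
Qed.

Section Step.
Variable e : 'I_N.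
Local Notation d := (e.+1).

Let step_cycle_fun (x : 'I_N) : 'I_N :=
  if x <= e then (if x == 0 :> nat then e else Ordinal (leq_ltn_trans (leq_pred x) (ltn_ord x)))
  else x.

Let step_cycle_fun_inj : injective step_cycle_fun.
Proof.
move=> x y; rewrite /step_cycle_fun => /(congr1 val).
case: ifP => xe; case: ifP => ye; do ?case: ifP => /eqP ?; do ?case: ifP => /eqP ?;
  rewrite /= => H; apply: val_inj => /=; lia.
Qed.

(** Dropping the first vertex of a (e + 1)-simplex and appending a new last
    one amounts to moving the first step to the end. *)
Definition step_cycle : 'S_N := perm step_cycle_fun_inj.

Lemma step_cycleE x : step_cycle x = (if x <= e then (if x == 0 :> nat then e : nat else x.-1) else x) :> nat.
Proof. by rewrite permE /step_cycle_fun; do 2?case: ifP. Qed.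

Definition raise_coord (a : 'I_N) (z : corner) : corner :=
  [ffun b => if b == a then inord (z a).+1 else z b].
Definition lower_coord (a : 'I_N) (z : corner) : corner :=
  [ffun b => if b == a then inord (z a).-1 else z b].

Lemma raise_coordE a (z : corner) b : z a < k -> raise_coord a z b = z b + (b == a) :> nat.
Proof.
move=> zk; rewrite ffunE; case: eqP => [->|_]; last by rewrite addn0.
by rewrite inordK ?addn1 ?ltnS.
Qed.
Lemma lower_coordE a (z : corner) b : lower_coord a z b = z b - (b == a) :> nat.
Proof.
rewrite ffunE; case: eqP => [->|_]; last by rewrite subn0.
by rewrite inordK ?subn1 // (leq_ltn_trans (leq_pred _)).
Qed.

Lemma raise_coordK a (z : corner) : z a < k -> lower_coord a (raise_coord a z) = z.
Proof. by move=> zk; apply/ffunP => b; apply: val_inj; rewrite /= lower_coordE raise_coordE// addnK. Qed.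
Lemma lower_coordK a (z : corner) : 0 < z a -> raise_coord a (lower_coord a z) = z.
Proof.
move=> zk; apply/ffunP => b; apply: val_inj; rewrite /= raise_coordE ?lower_coordE ?eqxx.
  by case: eqP => [->|_] /=; lia.
by have := ltn_ord (z a); lia.
Qed.

Lemma kuhn_vertex_shift a (z : corner) (r : 'S_N) j : r a = 0 :> nat -> z a < k -> j <= e ->
  kuhn_vertex (raise_coord a z, r * step_cycle)%g j = kuhn_vertex (z, r) j.+1.
Proof.
move=> ra zk je; apply/ffunP => b; rewrite ffunE [RHS]ffunE /= raise_coordE// permM step_cycleE.
have [->|ba] := eqVneq b a; first by rewrite ra /=; lia.
have rb : r b <> 0 :> nat.
  by move=> rb; move/eqP: ba; apply; apply: (@perm_inj _ r); apply: val_inj; rewrite /= ra.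
by do 2?[case: ifP]; lia.
Qed.

Lemma kuhn_vertex_swap (z : corner) (r : 'S_N) (p q : 'I_N) (j : nat) : q = p.+1 :> nat -> j <> q ->
  kuhn_vertex (z, r * tperm p q)%g j = kuhn_vertex (z, r) j.
Proof.
move=> pq jq; apply/ffunP => b; rewrite !ffunE /= permM.
by case: tpermP => [->|->|//]; lia.
Qed.

Let o0 : 'I_N := Ordinal (leq_ltn_trans (leq0n e) (ltn_ord e)).
Let p0 : 'I_N.+1 := ord0.
Let pd : 'I_N.+1 := Ordinal (ltn_ord e : d < N.+1).
(* the two steps exchanged at an inner facet j, where 0 < j < d, so that the
   default value o0 does not occur *)
Let oj (j : 'I_N.+1) : 'I_N := insubd o0 (j : nat).
Let oj1 (j : 'I_N.+1) : 'I_N := insubd o0 (j.-1).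

Definition first_axis (s : cell) : 'I_N := (s.2)^-1%g o0.
Definition last_axis (s : cell) : 'I_N := (s.2)^-1%g e.

(** The same facet seen from the simplex on its other side: an inner facet
    is shared with the simplex in which two consecutive steps are exchanged,
    the first and the last facet with a translate by a unit vector. *)
Definition adjacent_door (x : cell * 'I_N.+1) : cell * 'I_N.+1 :=
  let: (z, r, j) := x in
  if j == 0 :> nat then ((raise_coord (first_axis x.1) z, r * step_cycle)%g, pd)
  else if j == d :> nat then ((lower_coord (last_axis x.1) z, r * step_cycle^-1)%g, p0)
  else ((z, r * tperm (oj1 j) (oj j))%g, j).

Definition doors : {set cell * 'I_N.+1} :=
  [set x : cell * 'I_N.+1 | [&& kuhn_simplex d x.1, x.2 <= d & door d x.1 x.2]].
(** The doors that lie in a face x_a = k of the grid and hence in only one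
    simplex. *)
Definition boundary_doors : {set cell * 'I_N.+1} :=
  [set x : cell * 'I_N.+1 in doors | (x.2 == 0 :> nat) && (x.1.1 (first_axis x.1) == k.-1 :> nat)].

Let eN : d <= N. Proof. exact: ltn_ord. Qed.

(** Double counting of the pairs of a simplex and one of its doors. *)
Lemma odd_card_doors : odd #|doors| = odd #|[set s | kuhn_simplex d s && rainbow d s]|.
Proof.
have -> : #|doors| = \sum_(s | kuhn_simplex d s) #|[set j in verts d | door d s j]|.
  rewrite -sum1_card (eq_bigl (fun x : cell * 'I_N.+1 =>
     kuhn_simplex d x.1 && (x.2 \in [set j in verts d | door d x.1 j]))); last first.
    by move=> x; rewrite !inE.
  rewrite -(pair_big_dep (kuhn_simplex d)
    (fun s j => j \in [set j in verts d | door d s j]) (fun _ _ => 1)) /=.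
  by apply: eq_bigr => s _; rewrite sum1_card.
rewrite (big_morph odd oddD (erefl _)) -sum1_card (big_morph odd oddD (erefl _)).
rewrite [RHS](eq_bigl (fun s => kuhn_simplex d s && rainbow d s)); last by move=> s; rewrite inE.
rewrite big_mkcondr /=; apply: eq_bigr => s sd; rewrite odd_doors//.
by case: (rainbow d s).
Qed.

Let first_axisK (s : cell) : s.2 (first_axis s) = o0.
Proof. by rewrite /first_axis permKV. Qed.
Let last_axisK (s : cell) : s.2 (last_axis s) = e.
Proof. by rewrite /last_axis permKV. Qed.

Let step_cycle0 : step_cycle o0 = e.
Proof. by apply: val_inj; rewrite /= step_cycleE. Qed.
Let step_cycleVe : step_cycle^-1%g e = o0.
Proof. by rewrite -step_cycle0 permK. Qed.
Let step_cycle_ge (a : 'I_N) : e < a -> step_cycle a = a.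
Proof. by move=> ea; apply: val_inj; rewrite /= step_cycleE leqNgt ea. Qed.
Let step_cycleV_ge (a : 'I_N) : e < a -> step_cycle^-1%g a = a.
Proof. by move=> ea; rewrite -{1}(step_cycle_ge ea) permK. Qed.

Arguments adjacent_door : simpl never.

Lemma adjacent_door_first (z : corner) (r : 'S_N) (j : 'I_N.+1) : j = 0 :> nat ->
  adjacent_door ((z, r), j) = ((raise_coord (first_axis (z, r)) z, r * step_cycle)%g, pd).
Proof. by move=> j0; rewrite /adjacent_door j0. Qed.
Lemma adjacent_door_last (z : corner) (r : 'S_N) (j : 'I_N.+1) : j = d :> nat ->
  adjacent_door ((z, r), j) = ((lower_coord (last_axis (z, r)) z, r * step_cycle^-1)%g, p0).
Proof. by move=> jd; rewrite /adjacent_door jd eqxx. Qed.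
Lemma adjacent_door_mid (z : corner) (r : 'S_N) (j : 'I_N.+1) : j <> 0 :> nat -> j <> d :> nat ->
  adjacent_door ((z, r), j) = ((z, r * tperm (oj1 j) (oj j))%g, j).
Proof. by move=> j0 jd; rewrite /adjacent_door; case: eqP => //; case: eqP. Qed.

Lemma adjacent_door_involution x : x \in doors -> x \notin boundary_doors ->
  [/\ adjacent_door x \in doors :\: boundary_doors,
      adjacent_door (adjacent_door x) = x & adjacent_door x != x].
Proof.
case: x => -[z r] j xd xb.
have /and3P[/= sd jd /(doorP _ _ eN) dr] : [&& kuhn_simplex d (z, r), j <= d & door d (z, r) j].
  by move: xd; rewrite inE.
have nb : j = 0 :> nat -> z (first_axis (z, r)) <> k.-1 :> nat.
  by move=> j0 zk; move: xb; rewrite inE xd /= j0 zk !eqxx.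
have /kuhn_simplexP /= [zlt zge] := sd.
have plt a := simplex_perm_lt a sd; rewrite /= in plt.
have [j0|/eqP j0] := eqVneq (j : nat) 0; last have [jed|/eqP jed] := eqVneq (j : nat) d.
- set a0 := first_axis (z, r); have ra0 : r a0 = o0 := first_axisK (z, r).
  have a0d : a0 < d by rewrite -plt ra0.
  have za0 := zlt _ a0d; have {}nb := nb j0; rewrite -/a0 in nb.
  rewrite adjacent_door_first//; split; last by apply/eqP => /(congr1 (fun x => val x.2)); rewrite /pd /= j0.
    rewrite !inE /= andbF /= leqnn /=; apply/andP; split.
      apply/kuhn_simplexP; split=> a ad /=.
        rewrite raise_coordE// -/a0; have := zlt _ ad; case: eqP => [->|_] /=;
          move: nb; case: (z a0) => w /= _; lia.
      have [za ra] := zge _ ad; rewrite raise_coordE// -/a0 permM ra step_cycle_ge//; split=> //.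
      by case: eqP => [aa0|_]; [rewrite aa0 in ad; lia|lia].
    apply/doorP => // c cd; have [i [id ij <-]] := dr c cd.
    have i1 : 0 < i by rewrite lt0n -j0.
    exists i.-1; split; rewrite /=; try lia.
    by rewrite kuhn_vertex_shift ?ra0// ?prednK//; lia.
  rewrite adjacent_door_last//= -/a0.
  have -> : last_axis (raise_coord a0 z, (r * step_cycle)%g) = a0.
    by apply: (@perm_inj _ (r * step_cycle)); rewrite (last_axisK (raise_coord a0 z, (r * step_cycle)%g)) permM ra0 step_cycle0.
  by rewrite raise_coordK// mulgK; congr (_, _); apply: val_inj; rewrite /= j0.
- set a1 := last_axis (z, r); have ra1 : r a1 = e := last_axisK (z, r).
  have a1d : a1 < d by rewrite -plt ra1.
  (* a door does not lie in a face x_a = 0, where the colour a is missing *)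
  have za1 : 0 < z a1.
    rewrite lt0n; apply/eqP => za1.
    have [i [id ij ca]] := dr _ a1d.
    have := col0 (v := kuhn_vertex (z, r) i) (a := a1).
    rewrite ca eqxx => H; suff: false by []; apply: H.
    by rewrite ffunE /= za1 ra1; move: ij; rewrite jed; lia.
  have ra1' : (r * step_cycle^-1)%g a1 = o0 by rewrite permM ra1 step_cycleVe.
  have za1' : lower_coord a1 z a1 < k by rewrite lower_coordE eqxx subn1 -ltnS prednK.
  have sh i : i <= e -> kuhn_vertex (z, r) i = kuhn_vertex (lower_coord a1 z, (r * step_cycle^-1)%g) i.+1.
    by move=> ie; rewrite -(kuhn_vertex_shift (a := a1))// ?ra1'// lower_coordK// mulgKV.
  have fa : first_axis (lower_coord a1 z, (r * step_cycle^-1)%g) = a1.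
    apply: (@perm_inj _ (r * step_cycle^-1)).
    by rewrite (first_axisK (lower_coord a1 z, (r * step_cycle^-1)%g)) permM ra1 step_cycleVe.
  rewrite adjacent_door_last//; split; last by apply/eqP => /(congr1 (fun x => val x.2)); rewrite /pd /p0 /= jed.
    rewrite !inE /= -/a1 fa.
    have -> : (lower_coord a1 z a1 == k.-1 :> nat) = false.
      by rewrite lower_coordE eqxx /=; move: za1 (zlt _ a1d); case: (z a1) => w /= _; lia.
    rewrite andbF /=; apply/andP; split.
      apply/kuhn_simplexP; split=> a ad /=.
        by rewrite lower_coordE; have := zlt _ ad; lia.
      have [za ra] := zge _ ad; rewrite lower_coordE permM ra step_cycleV_ge//; split=> //.
      by case: eqP => [aa1|_]; [rewrite aa1 in ad; lia|lia].
    apply/doorP => // c cd; have [i [id ij <-]] := dr c cd.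
    exists i.+1; split=> //; first by move: ij; rewrite jed; lia.
    by rewrite sh//; move: ij; rewrite jed; lia.
  rewrite adjacent_door_first//= -/a1 fa lower_coordK// mulgKV.
  by congr (_, _); apply: val_inj; rewrite /= jed.
- have jN : j < N by have := ltn_ord e; lia.
  have qE : oj j = j :> nat by rewrite /oj val_insubd jN.
  have pE : oj1 j = j.-1 :> nat by rewrite /oj1 val_insubd (leq_ltn_trans (leq_pred _)).
  have pq : oj j = (oj1 j).+1 :> nat by rewrite qE pE prednK// lt0n; apply/eqP.
  rewrite !adjacent_door_mid//; split.
  + have jb : (j == 0 :> nat) = false by apply/eqP.
    rewrite !inE /= jb /= andbF /= jd /=; apply/andP; split.
      apply/kuhn_simplexP; split=> a ad /=; first exact: zlt.
      have [za ra] := zge _ ad; rewrite permM ra tpermD//; apply/eqP => /(congr1 val)/=; lia.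
    apply/doorP => // c cd; have [i [id ij <-]] := dr c cd.
    by exists i; split=> //; rewrite kuhn_vertex_swap// qE; apply/eqP.
  + by rewrite -mulgA tperm2 mulg1.
  + apply/eqP => -[] /(congr1 (fun s : 'S_N => s (r^-1%g (oj j)))).
    by rewrite permM permKV tpermR => /(congr1 val)/=; lia.
Qed.

(** A door in the face x_a = k shows the colour e, so e <= a by the boundary
    condition; as a <= e, the face is x_e = k and the door is a rainbow
    e-simplex of it. *)
Lemma card_boundary_doors :
  #|boundary_doors| = #|[set s | kuhn_simplex e s && rainbow e s]|.
Proof.
have eN' : e <= N by apply: ltnW.
pose h (s : cell) : cell * 'I_N.+1 := ((lower_coord e s.1, s.2 * step_cycle^-1)%g, p0).
have hinj : {in [set s | kuhn_simplex e s && rainbow e s] &, injective h}.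
  move=> [z r] [z' r']; rewrite !inE => /andP[/kuhn_simplexP[_ /= H] _] /andP[/kuhn_simplexP[_ /= H'] _].
  move=> [zz /mulIg ->]; congr (_, _).
  have [ze _] := H _ (leqnn _); have [ze' _] := H' _ (leqnn _).
  by rewrite -(@lower_coordK e z) ?ze// zz lower_coordK// ze'.
rewrite -(card_in_imset hinj); apply: eq_card => -[[z r] j].
apply/idP/imsetP => [xb|[[z' r']]].
  have xd : ((z, r), j) \in doors by move: xb; rewrite inE => /andP[].
  have /and3P[/= sd jd /(doorP _ _ eN) dr] : [&& kuhn_simplex d (z, r), j <= d & door d (z, r) j].
    by move: xd; rewrite inE.
  have /kuhn_simplexP /= [zlt zge] := sd.
  have plt a := simplex_perm_lt a sd; rewrite /= in plt.
  move: xb; rewrite inE xd /= => /andP[/eqP j0 /eqP].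
  set a0 := first_axis (z, r); have ra0 : r a0 = o0 := first_axisK (z, r) => zk.
  have a0d : a0 < d by rewrite -plt ra0.
  have a0e : a0 = e.
    have [i [id ij ce]] := dr _ (ltnSn e).
    have : e <= a0.
      rewrite -ce; apply: colk; rewrite ffunE /= zk ra0 /=.
      by move: ij; rewrite j0; lia.
    by move=> ea; apply: val_inj => /=; lia.
  have za := zlt _ a0d; rewrite a0e in ra0 za zk.
  exists (raise_coord e z, (r * step_cycle)%g).
    rewrite inE; apply/andP; split.
      apply/kuhn_simplexP; split=> a ea /=.
        by rewrite raise_coordE//; have := zlt a (ltnW ea);
          case: (eqVneq a e) => [ae|_]; [by rewrite ae ltnn in ea|rewrite addn0; lia].
      rewrite raise_coordE// permM; have [->|ae] := eqVneq a e.
        by rewrite ra0 zk step_cycle0 /=; split=> //; rewrite addn1 prednK.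
      have ea' : e < a by rewrite ltn_neqAle ea andbT eq_sym; exact: ae.
      by have [-> ->] := zge _ ea'; rewrite step_cycle_ge// addn0.
    apply/rainbowP => // c ce; have [i [id ij <-]] := dr c ce.
    move: ij; rewrite j0 => ij; exists i.-1; first lia.
    by rewrite kuhn_vertex_shift ?ra0// ?prednK//; lia.
  by rewrite /h /= raise_coordK// mulgK; congr (_, _); apply: val_inj.
rewrite inE => /andP[/kuhn_simplexP[/= zlt zge] /(rainbowP _ eN') rb] [-> -> ->].
have [ze re] := zge _ (leqnn _).
have re' : (r' * step_cycle^-1)%g e = o0 by rewrite permM re step_cycleVe.
have ze' : lower_coord e z' e < k by rewrite lower_coordE eqxx ze /=; lia.
have sh i : i <= e -> kuhn_vertex (z', r') i = kuhn_vertex (lower_coord e z', (r' * step_cycle^-1)%g) i.+1.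
  by move=> ie; rewrite -(kuhn_vertex_shift (a := e))// ?re'// lower_coordK ?ze// mulgKV.
have fa : first_axis (lower_coord e z', (r' * step_cycle^-1)%g) = e.
  apply: (@perm_inj _ (r' * step_cycle^-1)).
  by rewrite (first_axisK (lower_coord e z', (r' * step_cycle^-1)%g)) re'.
rewrite !inE /= fa lower_coordE eqxx ze /= subn1 eqxx andbT; apply/andP; split.
  apply/kuhn_simplexP; split=> a ad /=.
    rewrite lower_coordE; have [->|ae] := eqVneq a e; first by rewrite ze /=; lia.
    have ea' : a < e by rewrite ltn_neqAle -ltnS ad andbT; exact: ae.
    by have := zlt _ ea'; lia.
  have [za ra] := zge _ (ltnW ad); rewrite lower_coordE permM ra step_cycleV_ge//; split=> //.
  by case: eqP => [ae|_]; [rewrite ae in ad; lia|lia].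
apply/doorP => // c cd; have [i ie <-] := rb c cd.
by exists i.+1; split=> //; rewrite sh.
Qed.

End Step.

(** Sperner's lemma with its parity: the inner doors cancel in pairs, so the
    number of rainbow simplices has the parity of the number of doors on the
    boundary, that is, of rainbow simplices one dimension lower. *)
Lemma odd_rainbow d : d <= N -> odd #|[set s | kuhn_simplex d s && rainbow d s]|.
Proof.
elim: d => [_|d IH dN].
  have -> : [set s | kuhn_simplex 0 s && rainbow 0 s] = [set ([ffun=> ord_max], 1%g)]; last by rewrite cards1.
  apply/setP => s; rewrite !inE; apply/andP/eqP => [[/kuhn_simplexP[_ H] _]|->].
    case: s H => z r /= H; congr pair.
      by apply/ffunP => a; apply: val_inj; rewrite ffunE /=; have [] := H a (leq0n _).
    by apply/permP => a; rewrite perm1; have [] := H a (leq0n _).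
  split; first by apply/kuhn_simplexP; split=> // a _; rewrite ffunE perm1.
  apply/rainbowP => // c; rewrite leqn0 => /eqP->; exists 0 => //.
  apply/eqP; rewrite -leqn0; have [N0|N0] := posnP N; first by rewrite -[X in _ <= X]N0.
  by apply: (colk (a := Ordinal N0)); rewrite !ffunE /= addn0.
set e := Ordinal dN; rewrite -[d.+1]/(e.+1) -odd_card_doors -(cardsID (boundary_doors e)).
have sub : doors e :&: boundary_doors e = boundary_doors e.
  by apply/setIidPr/subsetP => x; rewrite inE => /andP[].
rewrite oddD sub card_boundary_doors [odd #|_ :\: _|]negbTE ?addbF; first by rewrite IH// ltnW.
apply: (@involution_even _ (adjacent_door e)) => x; rewrite inE => /andP[xb xd].
exact: adjacent_door_involution.
Qed.

(** All vertices of a rainbow simplex lie in one unit cube. *)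
Theorem cubical_sperner : exists z : {ffun 'I_N -> nat},
  (forall a, z a < k) /\
  forall c, c <= N -> exists u : {ffun 'I_N -> bool}, col [ffun a => z a + u a] = c.
Proof.
have := odd_rainbow (leqnn N); case: (set_0Vmem [set s | kuhn_simplex N s && rainbow N s]).
  by move=> ->; rewrite cards0.
move=> [s]; rewrite inE => /andP[/kuhn_simplexP[zlt _] /(rainbowP _ (leqnn N)) rb] _.
exists [ffun a => s.1 a : nat]; split=> [a|c cN]; first by rewrite ffunE; apply: zlt.
have [j jN <-] := rb c cN; exists [ffun a => s.2 a < j].
by congr col; apply/ffunP => a; rewrite !ffunE.
Qed.

End CubicalSperner.

From mathcomp Require Import all_classical all_reals all_analysis.

Import Order.TTheory GRing.Theory Num.Theory.
Import numFieldNormedType.Exports.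
Local Open Scope classical_set_scope.
Local Open Scope ring_scope.

(** * The comparison inequality *)

Section EuclideanPlane.
Context {R : realType} {n : nat}.

Lemma euclidean_mdistE (u v : euclidean R n) :
  mdist u v = Num.sqrt (\sum_i (u ord0 i - v ord0 i) ^+ 2).
Proof. by []. Qed.

Definition euclidean_segment (u v : euclidean R n) (s : R) : euclidean R n :=
  \row_i (u ord0 i + s / mdist u v * (v ord0 i - u ord0 i)).

Lemma euclidean_segment_geodesic (u v : euclidean R n) :
  geodesic_from_to u v (euclidean_segment u v).
Proof.
have [uv|uv] := eqVneq (mdist u v) 0.
  have <- := mdist_positivity _ _ uv.
  have e s : euclidean_segment u u s = u.
    by apply/rowP => i; rewrite !mxE subrr mulr0 addr0.
  rewrite /geodesic_from_to mdistxx; split=> //.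
  move=> s t; rewrite /= !in_itv /= -!eq_le => /eqP <- /eqP <-.
  by rewrite mdistxx subrr normr0.
split.
- move=> s t _ _; rewrite euclidean_mdistE.
  have -> : \sum_i (euclidean_segment u v s ord0 i - euclidean_segment u v t ord0 i) ^+ 2
     = ((s - t) / mdist u v) ^+ 2 * \sum_i (u ord0 i - v ord0 i) ^+ 2.
    by rewrite mulr_sumr; apply: eq_bigr => i _; rewrite !mxE; ring.
  rewrite sqrtrM ?sqr_ge0// sqrtr_sqr -euclidean_mdistE normrM normfV.
  by rewrite (ger0_norm (mdist_ge0 _ _)) divfK.
- by apply/rowP => i; rewrite !mxE mul0r mul0r addr0.
- by apply/rowP => i; rewrite !mxE divff// mul1r addrC subrK.
Qed.

End EuclideanPlane.

Section Hinge.
Context {R : realType} {X : metricType R}.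
Hypothesis catX : CAT0 X.

Definition triple {T : Type} (x y z : T) (i : 'I_3) : T :=
  match val i with 0%N => x | 1%N => y | _ => z end.

Lemma geodesic_onS (I J : set R) (c : R -> X) :
  J `<=` I -> geodesic_on I c -> geodesic_on J c.
Proof. by move=> JI cI s t /JI Is /JI It; apply: cI. Qed.

Lemma geodesic_itvE (a s t : R) (c : R -> X) : geodesic_on `[0, a] c ->
  0 <= s <= a -> 0 <= t <= a -> mdist (c s) (c t) = `|s - t|.
Proof. by move=> ca sa ta; apply: ca; rewrite /= in_itv. Qed.

(** The comparison inequality in the form in which it is used everywhere
    below: the right-hand side is the squared distance of the corresponding
    points on two sides of a Euclidean triangle with side lengths a, b and
    mdist (c1 a) (c2 b), by the law of cosines.  The comparison triangle is
    placed with vertices (0, 0), (a, 0) and (wx, wy); sides of length 0 are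
    treated apart because of the divisions by a and b. *)
Lemma hinge (c1 c2 : R -> X) (a b l m : R) :
  geodesic_on `[0, a] c1 -> geodesic_on `[0, b] c2 -> c1 0 = c2 0 ->
  0 <= a -> 0 <= b -> 0 <= l <= 1 -> 0 <= m <= 1 ->
  mdist (c1 (l * a)) (c2 (m * b)) ^+ 2 <=
    l ^+ 2 * a ^+ 2 + m ^+ 2 * b ^+ 2
    - l * m * (a ^+ 2 + b ^+ 2 - mdist (c1 a) (c2 b) ^+ 2).
Proof.
move=> g1 g2 c12 a0 b0 /andP[l0 l1] /andP[m0 m1].
have la : 0 <= l * a <= a by rewrite mulr_ge0//= ler_piMl.
have mb : 0 <= m * b <= b by rewrite mulr_ge0//= ler_piMl.
have d1 : mdist (c1 0) (c1 a) = a.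
  by rewrite (geodesic_itvE g1) ?lexx ?a0// sub0r normrN ger0_norm.
have d2 : mdist (c2 0) (c2 b) = b.
  by rewrite (geodesic_itvE g2) ?lexx ?b0// sub0r normrN ger0_norm.
have [a00|an0] := eqVneq a 0.
  rewrite a00 !mulr0 c12 (geodesic_itvE g2) ?lexx ?b0// d2 sub0r normrN ger0_norm//; last by case/andP: mb.
  by rewrite le_eqVlt; apply/orP; left; apply/eqP; ring.
have a_gt0 : 0 < a by rewrite lt_neqAle eq_sym an0.
set p := c1 0; set x := c1 a; set y := c2 b.
set D := mdist x y.
have D0 : 0 <= D by apply: mdist_ge0.
have Dab : D <= a + b.
  by rewrite (le_trans (metric_triangle _ (c1 0) _))// metric_sym d1 /x c12 d2.
have aDb : a <= b + D.
  by rewrite -[leLHS]d1 c12 (le_trans (metric_triangle _ y _))// d2 lerD2l metric_sym.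
have bDa : b <= a + D.
  by rewrite -[leLHS]d2 -c12 (le_trans (metric_triangle _ x _))// d1.
have [c3 [g3 c30 c3D]] := catX.1 x y.
pose v := triple p x y.
pose c := triple c1 c3 (fun s => c2 (b - s)).
pose wx := (a ^+ 2 + b ^+ 2 - D ^+ 2) / (2 * a).
have wx2 : 0 <= b ^+ 2 - wx ^+ 2.
  have -> : b ^+ 2 - wx ^+ 2 =
     ((a + b - D) * (a + b + D)) * ((D - (a - b)) * (D + (a - b))) / (2 * a) ^+ 2.
    by rewrite /wx; field.
  by rewrite divr_ge0 ?sqr_ge0// !mulr_ge0//; lra.
pose wy := Num.sqrt (b ^+ 2 - wx ^+ 2).
have wyE : wy ^+ 2 = b ^+ 2 - wx ^+ 2 by rewrite sqr_sqrtr.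
pose vec (s t : R) : euclidean R 2 := \row_i (if i == 0 :> nat then s else t).
have vecE s t s' t' : mdist (vec s t) (vec s' t') = Num.sqrt ((s - s') ^+ 2 + (t - t') ^+ 2).
  by rewrite euclidean_mdistE !big_ord_recl big_ord0 !mxE /= addr0.
pose w := triple (vec 0 0) (vec a 0) (vec wx wy).
pose cw i := euclidean_segment (w i) (w (ordS i)).
have w01 : mdist (vec 0 0) (vec a 0) = a.
  by rewrite vecE subrr expr0n /= addr0 sub0r sqrrN sqrtr_sqr ger0_norm.
have w12 : mdist (vec a 0) (vec wx wy) = D.
  rewrite vecE sub0r sqrrN wyE.
  have -> : (a - wx) ^+ 2 + (b ^+ 2 - wx ^+ 2) = D ^+ 2 by rewrite /wx; field.
  by rewrite sqrtr_sqr ger0_norm.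
have w20 : mdist (vec wx wy) (vec 0 0) = b.
  by rewrite vecE !subr0 wyE addrC subrK sqrtr_sqr ger0_norm.
have v20 : mdist y p = b by rewrite metric_sym /p c12.
have Tv : geodesic_triangle v c.
  case=> -[|[|[|//]]] ? /=; rewrite /v /c /triple /=.
  - by split; rewrite -/p -/x /p /x ?d1.
  - by split; rewrite -/D.
  - split; rewrite ?v20 ?subr0 ?subrr// => s t; rewrite /= !in_itv /= => sb tb.
    rewrite (geodesic_itvE g2); [|lra|lra].
    by rewrite (_ : b - s - (b - t) = - (s - t)) ?normrN//; ring.
have Tw : geodesic_triangle w cw.
  by move=> i; exact: euclidean_segment_geodesic.
have dvw i : mdist (w i) (w (ordS i)) = mdist (v i) (v (ordS i)).
  case: i => -[|[|[|//]]] ?; rewrite /v /w /triple /=.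
  - by rewrite w01 d1.
  - by rewrite w12.
  - by rewrite w20 v20.
have := catX.2 v c w cw Tv Tw dvw (@Ordinal 3 0 isT) (@Ordinal 3 2 isT) (l * a) (b - m * b).
rewrite /v /c /cw /w /triple /= d1 v20 opprB addrCA subrr addr0 => /(_ la).
have mb' : 0 <= b - m * b <= b by lra.
move=> /(_ mb') H.
rewrite (le_trans (y := mdist (euclidean_segment (vec 0 0) (vec a 0) (l * a))
            (euclidean_segment (vec wx wy) (vec 0 0) (b - m * b)) ^+ 2))//.
  by rewrite ler_pXn2r// nnegrE mdist_ge0.
have -> : euclidean_segment (vec 0 0) (vec a 0) (l * a) = vec (l * a) 0.
  by rewrite /euclidean_segment w01; apply/rowP => i; rewrite !mxE; case: ifP => _; field.
have [b00|bn0] := eqVneq b 0.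
  have wx0 : wx = 0.
    apply/eqP; rewrite -sqrf_eq0 eq_le sqr_ge0 andbT.
    by move: wx2; rewrite b00 expr0n sub0r oppr_ge0.
  have wy0 : wy = 0 by rewrite /wy wx0 b00 subrr sqrtr0.
  have -> : euclidean_segment (vec wx wy) (vec 0 0) (b - m * b) = vec 0 0.
    by rewrite /euclidean_segment wx0 wy0; apply/rowP => i; rewrite !mxE; case: ifP => _;
      rewrite subrr mulr0 addr0.
  have Da : D = a by lra.
  rewrite vecE sqr_sqrtr ?addr_ge0 ?sqr_ge0// b00 Da.
  by rewrite le_eqVlt; apply/orP; left; apply/eqP; ring.
have -> : euclidean_segment (vec wx wy) (vec 0 0) (b - m * b) = vec (m * wx) (m * wy).
  by rewrite /euclidean_segment w20; apply/rowP => i; rewrite !mxE; case: ifP => _; field.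
rewrite vecE sqr_sqrtr ?addr_ge0 ?sqr_ge0//.
have -> : (l * a - m * wx) ^+ 2 + (0 - m * wy) ^+ 2
  = (l * a) ^+ 2 - 2 * l * a * m * wx + m ^+ 2 * wx ^+ 2 + m ^+ 2 * wy ^+ 2 by ring.
rewrite wyE /wx le_eqVlt; apply/orP; left; apply/eqP; field.
exact: an0.
Qed.

End Hinge.

(** * Metric and convexity estimates *)

Lemma le_add_inv (R : realType) (x y M T0 : R) :
  (forall T, T0 < T -> 0 < T -> x <= y + M / T) -> x <= y.
Proof.
move=> H; rewrite leNgt; apply/negP => yx.
have xy0 : 0 < x - y by rewrite subr_gt0.
pose T := `|T0| + `|M| / (x - y) + 1.
have T0' : 0 <= `|M| / (x - y) by rewrite divr_ge0// ltW.
have Tn := ler_norm T0; have Tn0 := normr_ge0 T0.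
have Tgt : 0 < T by rewrite /T; lra.
have TT : T0 < T by rewrite /T; lra.
have := H T TT Tgt; rewrite -lerBlDl ler_pdivlMr//.
have : `|M| < (x - y) * T.
  rewrite /T !mulrDr [X in _ + X + _]mulrC divfK ?gt_eqF//.
  by have : 0 <= (x - y) * `|T0| by [rewrite mulr_ge0// ltW]; lra.
by have := ler_norm M; lra.
Qed.

Section MetricTopology.
Context {R : realType} {X : metricType R}.

Lemma open_mdistP (A : set X) :
  open A <-> forall x, A x -> exists2 e : R, 0 < e & forall y, mdist x y < e -> A y.
Proof.
rewrite openE; split=> H x /H.
  by rewrite /interior -metricType_numDomainType.nbhs_nbhs_mdist => -[e e0 eA]; exists e => // y xy; apply: eA.
by case=> e e0 eA; rewrite /interior -metricType_numDomainType.nbhs_nbhs_mdist; exists e => // y; apply: eA.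
Qed.

Lemma closed_mdist_le (x : X) (r : R) : closed [set y | mdist x y <= r].
Proof.
rewrite -[X in closed X]setCK; apply: open_closedC; apply/open_mdistP => y /=.
move/negP; rewrite -ltNge => ry; exists (mdist x y - r); first by rewrite subr_gt0.
move=> z yz; apply/negP; rewrite -ltNge.
by have := metric_triangle x z y; rewrite (metric_sym z); lra.
Qed.

Lemma compact_mdist_le (x : X) (r : R) : proper_space X -> compact [set y | mdist x y <= r].
Proof.
move=> pX; apply: pX; first exact: closed_mdist_le.
exists (r + r) => y z /= xy xz.
by rewrite (le_trans (metric_triangle _ x _))// lerD// metric_sym.
Qed.

(** The whole sequence lies in one compact ball; a cluster point is
    approached by terms of arbitrarily large index, all of which are within
    e m of u m. *)
Lemma proper_complete (u : nat -> X) (e : nat -> R) : proper_space X ->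
  (forall m n, (m <= n)%N -> mdist (u m) (u n) <= e m) ->
  exists l, forall m, mdist (u m) l <= e m.
Proof.
move=> pX ue; have cpt := @compact_mdist_le (u 0%N) (e 0%N) pX.
have [|l [_ cl]] := cpt (u @ \oo) _.
  by exists 0%N => // n _; apply: ue.
exists l => m; apply/ler_addgt0Pr => eps eps0.
have [z [[n mn <-] /= lz]] : [set u n | n in [set n | (m <= n)%N]] `&` [set z | mdist l z < eps] !=set0.
  apply: cl; first by exists m => // n mn; exists n.
  by rewrite -metricType_numDomainType.nbhs_nbhs_mdist; exists eps.
rewrite (le_trans (metric_triangle _ (u n) _))// lerD ?ue//.
by rewrite metric_sym ltW.
Qed.

Lemma geodesic_rayE (c : R -> X) s t : geodesic_ray c -> 0 <= s -> 0 <= t ->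
  mdist (c s) (c t) = `|s - t|.
Proof. by move=> rc s0 t0; apply: rc; rewrite /= in_itv /= andbT. Qed.

Lemma geodesic_ray_itv (c : R -> X) a : geodesic_ray c -> geodesic_on `[0, a] c.
Proof.
by move=> rc; apply: geodesic_onS rc => s /=; rewrite !in_itv /= andbT => /andP[].
Qed.

Lemma geodesic_on_rev (c : R -> X) a : geodesic_on `[0, a] c ->
  geodesic_on `[0, a] (fun s => c (a - s)).
Proof.
move=> ca s t; rewrite /= !in_itv /= => sa ta.
by rewrite (geodesic_itvE ca) ?(distrC s); [congr (`| _ |); ring|lra|lra].
Qed.

End MetricTopology.

Section CAT0.
Context {R : realType} {X : metricType R}.
Hypothesis catX : CAT0 X.

(** The inequality of Bruhat and Tits, with a general ratio: the hinge
    inequality with one of the two points at the end of its side. *)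
Lemma cat0_cn (c : R -> X) a l z : geodesic_on `[0, a] c -> 0 <= a -> 0 <= l <= 1 ->
  mdist (c (l * a)) z ^+ 2 <= (1 - l) * mdist (c 0) z ^+ 2 + l * mdist (c a) z ^+ 2
     - l * (1 - l) * a ^+ 2.
Proof.
move=> gc a0 l01; have [c2 [g2 c20 c2z]] := catX.1 (c 0) z.
have := @hinge R X catX c c2 a _ l 1 gc g2 (esym c20) a0 (mdist_ge0 _ _) l01.
rewrite ler01 lexx mul1r c2z => /(_ isT) /le_trans; apply.
by rewrite le_eqVlt; apply/orP; left; apply/eqP; ring.
Qed.

Lemma cat0_convex_point (c : R -> X) a l z : geodesic_on `[0, a] c -> 0 <= a -> 0 <= l <= 1 ->
  mdist (c (l * a)) z <= (1 - l) * mdist (c 0) z + l * mdist (c a) z.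
Proof.
move=> gc a0 l01; have /andP[l0 l1] := l01.
have d0 := mdist_ge0 (c 0) z; have d1 := mdist_ge0 (c a) z.
have da : mdist (c 0) (c a) = a.
  by rewrite (geodesic_itvE gc) ?lexx ?a0// sub0r normrN ger0_norm.
have rhs0 : 0 <= (1 - l) * mdist (c 0) z + l * mdist (c a) z.
  by rewrite addr_ge0// mulr_ge0// subr_ge0.
rewrite -(@ler_pXn2r _ 2)// ?nnegrE ?mdist_ge0//.
rewrite (le_trans (cat0_cn z gc a0 l01))// -subr_ge0.
have -> : ((1 - l) * mdist (c 0) z + l * mdist (c a) z) ^+ 2 -
  ((1 - l) * mdist (c 0) z ^+ 2 + l * mdist (c a) z ^+ 2 - l * (1 - l) * a ^+ 2)
  = l * (1 - l) * ((a - (mdist (c 0) z - mdist (c a) z)) * (a + (mdist (c 0) z - mdist (c a) z))).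
  by ring.
have t1 := metric_triangle (c 0) (c a) z.
have t2 := metric_triangle (c a) (c 0) z; rewrite (metric_sym (c a) (c 0)) in t2.
by rewrite !mulr_ge0//; lra.
Qed.

Lemma cat0_contract (c1 c2 : R -> X) a b l :
  geodesic_on `[0, a] c1 -> geodesic_on `[0, b] c2 -> c1 0 = c2 0 ->
  0 <= a -> 0 <= b -> 0 <= l <= 1 ->
  mdist (c1 (l * a)) (c2 (l * b)) <= l * mdist (c1 a) (c2 b).
Proof.
move=> g1 g2 e a0 b0 l01; have /andP[l0 l1] := l01.
rewrite -(@ler_pXn2r _ 2)// ?nnegrE ?mulr_ge0 ?mdist_ge0//.
rewrite (le_trans (hinge catX g1 g2 e a0 b0 l01 l01))//.
by rewrite le_eqVlt; apply/orP; left; apply/eqP; ring.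
Qed.

(** A quadrilateral is cut into two triangles by a diagonal c3, and
    cat0_contract is used at both ends of c3. *)
Lemma cat0_convex (c1 c2 : R -> X) a b l :
  geodesic_on `[0, a] c1 -> geodesic_on `[0, b] c2 ->
  0 <= a -> 0 <= b -> 0 <= l <= 1 ->
  mdist (c1 (l * a)) (c2 (l * b)) <= (1 - l) * mdist (c1 0) (c2 0) + l * mdist (c1 a) (c2 b).
Proof.
move=> g1 g2 a0 b0 l01; have [c3 [g3 c30 c3D]] := catX.1 (c1 0) (c2 b).
have l01' : 0 <= 1 - l <= 1 by lra.
rewrite (le_trans (metric_triangle _ (c3 (l * mdist (c1 0) (c2 b))) _))// addrC lerD//.
  have := @cat0_contract _ _ _ _ (1 - l) (geodesic_on_rev g3) (geodesic_on_rev g2).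
  rewrite !subr0 c3D !subrr c30 => /(_ erefl (mdist_ge0 _ _) b0 l01').
  by have e (x : R) : x - (1 - l) * x = l * x by [ring]; rewrite !e.
have := cat0_contract g1 g3 (esym c30) a0 (mdist_ge0 _ _) l01.
by rewrite c3D.
Qed.

(** Measure both y and w from the midpoint m of x and z. *)
Lemma cat0_quad (x y z w : X) :
  mdist x z ^+ 2 + mdist y w ^+ 2 <=
  mdist x y ^+ 2 + mdist y z ^+ 2 + mdist z w ^+ 2 + mdist w x ^+ 2.
Proof.
have [c [gc c0 cD]] := catX.1 x z.
have h : 0 <= (2^-1 : R) <= 1 by lra.
have := cat0_cn y gc (mdist_ge0 _ _) h.
have := cat0_cn w gc (mdist_ge0 _ _) h.
rewrite c0 cD; set m := c _ => Hw Hy.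
have t := metric_triangle y m w; rewrite (metric_sym y m) in t.
have : mdist y w ^+ 2 <= (mdist m y + mdist m w) ^+ 2.
  by rewrite ler_pXn2r// nnegrE ?addr_ge0 ?mdist_ge0.
have : (mdist m y + mdist m w) ^+ 2 <= 2 * (mdist m y ^+ 2 + mdist m w ^+ 2).
  rewrite -subr_ge0 (_ : _ - _ = (mdist m y - mdist m w) ^+ 2) ?sqr_ge0//; ring.
rewrite (metric_sym y z) (metric_sym w x).
by lra.
Qed.

End CAT0.

(** * Lines and asymptotic rays *)

Lemma ratio_itv (R : realFieldType) (s D : R) : 0 <= s -> 0 < D -> s <= D -> 0 <= s / D <= 1.
Proof.
move=> s0 D0 sD; apply/andP; split; first by rewrite divr_ge0 ?(ltW D0).
by rewrite ler_pdivrMr// mul1r.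
Qed.

Section LocalGeodesics.
Context {R : realType} {X : metricType R}.
Hypothesis catX : CAT0 X.

(** For u < m < v the angle at c m between the two halves is straight: points
    at a small distance q on both sides of c m have distance 2 * q.  By the
    hinge inequality this straightness persists up to c u and c v. *)
Lemma geodesic_on_glue (c : R -> X) s m t r : 0 < r -> s <= m - r -> m <= t ->
  geodesic_on `[s, m] c -> geodesic_on `[m - r, t] c -> geodesic_on `[s, t] c.
Proof.
move=> r0 sm mt g1 g2.
suff H u v : s <= u -> u <= v -> v <= t -> mdist (c u) (c v) = v - u.
  move=> u v; rewrite /= !in_itv /= => /andP[su ut] /andP[sv vt].
  have [uv|/ltW vu] := leP u v; first by rewrite H// distrC ger0_norm// subr_ge0.
  by rewrite metric_sym H// ger0_norm// subr_ge0.
move=> su uv vt.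
have [vm|mv] := leP v m.
  by rewrite g1 /= ?in_itv /= ?su ?(le_trans uv)// ?(le_trans su uv)// distrC ger0_norm// subr_ge0.
have [um|um] := leP (m - r) u.
  rewrite g2 /= ?in_itv /= ?um ?(le_trans uv)// ?(le_trans um uv)// distrC ger0_norm// subr_ge0//.
set a := m - u; set b := v - m.
have a0 : 0 < a by rewrite /a; lra.
have b0 : 0 < b by rewrite /b; lra.
have ra : r < a by rewrite /a; lra.
pose q := Num.min r b.
have q0 : 0 < q by rewrite lt_min r0.
have qr : q <= r by rewrite ge_min lexx.
have qb : q <= b by rewrite ge_min lexx orbT.
have G1 : geodesic_on `[0, a] (fun x => c (m - x)).
  move=> x y; rewrite /= !in_itv /= => xa ya.
  rewrite g1 /= ?in_itv /=; [rewrite distrC; congr (`| _ |); ring|rewrite /a in xa; lra|rewrite /a in ya; lra].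
have G2 : geodesic_on `[0, b] (fun x => c (m + x)).
  move=> x y; rewrite /= !in_itv /= => xa ya.
  rewrite g2 /= ?in_itv /=; [congr (`| _ |); ring|rewrite /b in xa; lra|rewrite /b in ya; lra].
have l1 : 0 <= q / a <= 1.
  by apply: ratio_itv; lra.
have l2 : 0 <= q / b <= 1.
  by apply: ratio_itv; lra.
have e0 : c (m - 0) = c (m + 0) by rewrite subr0 addr0.
have := hinge catX G1 G2 e0 (ltW a0) (ltW b0) l1 l2.
rewrite !divfK ?gt_eqF//.
have -> : m - a = u by rewrite /a; ring.
have -> : m + b = v by rewrite /b; ring.
have -> : mdist (c (m - q)) (c (m + q)) = 2 * q.
  rewrite g2 /= ?in_itv /=; [|rewrite /b in qb; lra|rewrite /b in qb; lra].
  by rewrite (_ : _ - _ = - (2 * q)) ?normrN ?ger0_norm; [|lra|ring].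
set D := mdist (c u) (c v) => H.
have D0 : 0 <= D by apply: mdist_ge0.
have : (a + b) ^+ 2 <= D ^+ 2.
  rewrite -subr_ge0.
  have -> : D ^+ 2 - (a + b) ^+ 2 =
    ((q / a) ^+ 2 * a ^+ 2 + (q / b) ^+ 2 * b ^+ 2 -
      q / a * (q / b) * (a ^+ 2 + b ^+ 2 - D ^+ 2) - (2 * q) ^+ 2) * (a * b) / q ^+ 2.
    by field; rewrite !gt_eqF.
  by rewrite divr_ge0 ?sqr_ge0// mulr_ge0 ?subr_ge0// mulr_ge0// ltW.
rewrite ler_pXn2r// ?nnegrE ?(addr_ge0 (ltW a0) (ltW b0))// => abD.
have : D <= a + b.
  rewrite /D (le_trans (metric_triangle _ (c m) _))// lerD//.
    rewrite g1 /= ?in_itv /=; [|lra|lra].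
    by rewrite distrC ger0_norm; rewrite /a; lra.
  rewrite g2 /= ?in_itv /=; [|lra|lra].
  by rewrite distrC ger0_norm; rewrite /b; lra.
by rewrite /a /b in abD *; lra.
Qed.

(** The supremum of the times up to which the curve is minimizing cannot be
    smaller than t, because the curve minimizes around it and can be glued. *)
Lemma local_geodesic_geodesic (c : R -> X) : local_geodesic c ->
  forall s t, mdist (c s) (c t) = `|s - t|.
Proof.
move=> lc.
suff H s t : s <= t -> geodesic_on `[s, t] c.
  move=> s t; have [st|/ltW ts] := leP s t.
    by apply: (H _ _ st); rewrite /= in_itv /= ?lexx ?st.
  by apply: (H _ _ ts); rewrite /= in_itv /= ?lexx ?ts.
move=> st; pose S := [set u | s <= u <= t /\ geodesic_on `[s, u] c].
have Ss : S s.
  split; first by rewrite lexx.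
  move=> x y; rewrite /= !in_itv /= -!eq_le => /eqP <- /eqP <-.
  by rewrite mdistxx subrr normr0.
have Sub : ubound S t by move=> u [/andP[]].
have Ssup : has_sup S by split; [exists s|exists t].
have u0t : sup S <= t by apply: ge_sup => //; exists s.
have su0 : s <= sup S by apply: ub_le_sup => //; exists t.
have [e e0 ge] := lc (sup S).
have [u1 [/andP[su1 u1t] gu1] u1e] := sup_adherent e0 Ssup.
have u1u0 : u1 <= sup S by apply: ub_le_sup; [exists t|split => //; rewrite su1].
pose t' := Num.min t (sup S + e / 2).
have t't : t' <= t by rewrite ge_min lexx.
have t'e : t' <= sup S + e / 2 by rewrite ge_min lexx orbT.
have u0t' : sup S <= t' by rewrite le_min u0t /=; lra.
have inball x : sup S - e < x -> x <= t' -> ball (sup S) e x.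
  by move=> x1 x2; rewrite /ball /= ltr_norml; lra.
have St' : S t'.
  split; first by rewrite (le_trans su0)//=.
  have [se|se] := ltP (sup S - e) s.
    apply: geodesic_onS ge => x /=; rewrite in_itv /= => /andP[sx xt].
    by apply: inball => //; apply: lt_le_trans sx.
  apply: (@geodesic_on_glue c s u1 t' ((u1 - (sup S - e)) / 2)) => //; try lra.
  apply: geodesic_onS ge => x /=; rewrite in_itv /= => /andP[sx xt].
  by apply: inball => //; lra.
have : t' <= sup S by apply: ub_le_sup => //; exists t.
rewrite ge_min => /orP[tu|]; last by lra.
have <- : t' = t by apply/eqP; rewrite eq_le t't (le_trans tu).
by case: St'.
Qed.

Definition geodesic_line (c : R -> X) := forall s t, mdist (c s) (c t) = `|s - t|.

Hypothesis gcX : geodesically_complete X.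

Lemma extend_ray (c : R -> X) : geodesic_ray c ->
  exists2 l, geodesic_line l & forall t, 0 <= t -> l t = c t.
Proof.
move=> rc; have [|l [ll lc]] := gcX (@interval_is_interval _ `[(0:R), +oo[) _ rc.
  by exists 0, 1; split; rewrite /= ?in_itv /= ?lexx ?ler01 ?ltr01.
exists l; first exact: local_geodesic_geodesic.
by move=> t t0; apply: lc; rewrite /= in_itv /= t0.
Qed.

Lemma extend_segment (x y : X) : x != y ->
  exists l, [/\ geodesic_line l, l 0 = x & l (mdist x y) = y].
Proof.
move=> xy; have [c [gc c0 cD]] := catX.1 x y.
have D0 : 0 < mdist x y by rewrite mdist_gt0.
have [|l [ll lc]] := gcX (@interval_is_interval _ `[0, mdist x y]) _ gc.
  by exists 0, (mdist x y); split; rewrite /= ?in_itv /= ?lexx ?(ltW D0).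
exists l; split; first exact: local_geodesic_geodesic.
  by rewrite lc ?c0//= in_itv /= lexx ltW.
by rewrite lc ?cD//= in_itv /= lexx ltW.
Qed.

Lemma geodesic_line_ray (l : R -> X) : geodesic_line l -> geodesic_ray l.
Proof. by move=> ll s t _ _; apply: ll. Qed.

Lemma geodesic_line_shift (l : R -> X) a : geodesic_line l ->
  geodesic_line (fun t => l (a + t)).
Proof. by move=> ll s t; rewrite ll; congr (`| _ |); ring. Qed.

Lemma geodesic_line_rev (l : R -> X) : geodesic_line l ->
  geodesic_line (fun t => l (- t)).
Proof. by move=> ll s t; rewrite ll distrC; congr (`| _ |); ring. Qed.

End LocalGeodesics.

Section Asymptotic.
Context {R : realType} {X : metricType R}.

Lemma asymptotic_refl (c : R -> X) : asymptotic c c.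
Proof. by exists 0 => t _; rewrite mdistxx. Qed.

Lemma asymptotic_sym (c1 c2 : R -> X) : asymptotic c1 c2 -> asymptotic c2 c1.
Proof. by move=> [M H]; exists M => t t0; rewrite metric_sym H. Qed.

Lemma asymptotic_trans (c1 c2 c3 : R -> X) :
  asymptotic c1 c2 -> asymptotic c2 c3 -> asymptotic c1 c3.
Proof.
move=> [M H] [M' H']; exists (M + M') => t t0.
by rewrite (le_trans (metric_triangle _ (c2 t) _))// lerD ?H ?H'.
Qed.

Hypothesis catX : CAT0 X.

(** The distance between the two rays is convex and bounded in t. *)
Lemma asymptotic_contract (c1 c2 : R -> X) : geodesic_ray c1 -> geodesic_ray c2 ->
  asymptotic c1 c2 -> forall t, 0 <= t -> mdist (c1 t) (c2 t) <= mdist (c1 0) (c2 0).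
Proof.
move=> r1 r2 [M H] t t0; apply: (@le_add_inv _ _ _ (t * M) t) => T tT T0.
have l01 : 0 <= t / T <= 1.
  by apply: ratio_itv; rewrite // ltW.
have := cat0_convex catX (geodesic_ray_itv (a := T) r1) (geodesic_ray_itv (a := T) r2)
  (ltW T0) (ltW T0) l01.
rewrite !divfK ?gt_eqF// => /le_trans; apply; apply: lerD.
  by rewrite ler_piMl ?mdist_ge0//; lra.
by rewrite [leRHS]mulrAC ler_wpM2l ?H ?(ltW T0)//; case/andP: l01.
Qed.

Lemma asymptotic_eq (c1 c2 : R -> X) : geodesic_ray c1 -> geodesic_ray c2 ->
  asymptotic c1 c2 -> c1 0 = c2 0 -> forall t, 0 <= t -> c1 t = c2 t.
Proof.
move=> r1 r2 a12 e t t0; apply: mdist_positivity; apply/eqP.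
rewrite eq_le mdist_ge0 andbT.
by rewrite (le_trans (asymptotic_contract r1 r2 a12 t0))// e mdistxx.
Qed.

Hypothesis pX : proper_space X.

(** The ray is the limit of the geodesics sg k from p to g k.  The hinge at p
    with ends g k and g k' is thin, since D k' - D k differs from k' - k by at
    most 2 * d0; this is the Cauchy estimate est, of order s / sqrt k. *)
Lemma asymptotic_ray_from (g : R -> X) (p : X) : geodesic_ray g ->
  exists c, [/\ geodesic_ray c, asymptotic g c & c 0 = p].
Proof.
move=> rg; set d0 := mdist p (g 0).
have d00 : 0 <= d0 by apply: mdist_ge0.
have [sg sgP] := choice (fun k : nat => catX.1 p (g k%:R)).
pose D k := mdist p (g k%:R).
have Dlow (k : nat) : k%:R - d0 <= D k.
  rewrite lerBlDl -[leLHS]ger0_norm// -[k%:R in leLHS]subr0 distrC -(geodesic_rayE rg)//.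
  by rewrite (le_trans (metric_triangle _ p _))// (metric_sym _ p).
have DD (k k' : nat) : (k <= k')%N -> k'%:R - k%:R - 2 * d0 <= D k' - D k <= k'%:R - k%:R.
  move=> kk'; have gk : mdist (g k%:R) (g k'%:R) = k'%:R - k%:R.
    by rewrite geodesic_rayE// distrC ger0_norm// subr_ge0 ler_nat.
  have t1 := metric_triangle p (g k%:R) (g k'%:R).
  have Dup : D k <= d0 + k%:R.
    rewrite (le_trans (metric_triangle _ (g 0) _))// lerD2l geodesic_rayE//.
    by rewrite sub0r normrN ger0_norm.
  have := Dlow k'; rewrite -/(D k) -/(D k') in t1 *.
  by lra.
have est (k k' : nat) s : (k <= k')%N -> 0 <= s -> d0 + s < k%:R ->
   mdist (sg k s) (sg k' s) <= Num.sqrt (4 * d0 * s ^+ 2 / (k%:R - d0)).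
  move=> kk' s0 sk.
  have kd : 0 < k%:R - d0 by lra.
  have k'k : (k%:R : R) <= k'%:R by rewrite ler_nat.
  have [g1 e1 f1] := sgP k; have [g2 e2 f2] := sgP k'.
  rewrite -/(D k) in g1 f1; rewrite -/(D k') in g2 f2.
  have Dk := Dlow k; have Dk' := Dlow k'.
  have Dk0 : 0 < D k by lra.
  have Dk'0 : 0 < D k' by lra.
  have l1 : 0 <= s / D k <= 1.
    by apply: ratio_itv; lra.
  have l2 : 0 <= s / D k' <= 1.
    by apply: ratio_itv; lra.
  have := hinge catX g1 g2 (etrans e1 (esym e2)) (ltW Dk0) (ltW Dk'0) l1 l2.
  rewrite !divfK ?gt_eqF// f1 f2 => H.
  rewrite -[leLHS]ger0_norm ?mdist_ge0// -sqrtr_sqr ler_wsqrtr//.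
  apply: (le_trans H).
  have gk : mdist (g k%:R) (g k'%:R) = k'%:R - k%:R.
    by rewrite geodesic_rayE// distrC ger0_norm// subr_ge0.
  rewrite gk; have /andP[DD1 DD2] := DD _ _ kk'.
  have -> : (s / D k) ^+ 2 * D k ^+ 2 + (s / D k') ^+ 2 * D k' ^+ 2 -
    s / D k * (s / D k') * (D k ^+ 2 + D k' ^+ 2 - (k'%:R - k%:R) ^+ 2)
    = s ^+ 2 / (D k * D k') * (((k'%:R - k%:R) - (D k' - D k)) * ((k'%:R - k%:R) + (D k' - D k))).
    by field; rewrite !gt_eqF.
  have le1 : ((k'%:R - k%:R) - (D k' - D k)) * ((k'%:R - k%:R) + (D k' - D k))
     <= (2 * d0) * (2 * (k'%:R - k%:R)).
    have [h|h] := leP 0 ((k'%:R - k%:R) + (D k' - D k)).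
      by apply: ler_pM => //; lra.
    apply: (@le_trans _ _ 0); first by rewrite mulr_ge0_le0//; lra.
    by rewrite !mulr_ge0//; lra.
  have s2 : 0 <= s ^+ 2 / (D k * D k') by rewrite divr_ge0 ?sqr_ge0// mulr_ge0 ?(ltW Dk0) ?(ltW Dk'0).
  apply: (le_trans (ler_wpM2l s2 le1)).
  have -> : s ^+ 2 / (D k * D k') * ((2 * d0) * (2 * (k'%:R - k%:R)))
     = (4 * d0 * s ^+ 2) * ((k'%:R - k%:R) / D k' / D k) by field; rewrite !gt_eqF.
  rewrite ler_wpM2l ?mulr_ge0 ?sqr_ge0//.
  rewrite -[leRHS]mul1r ler_pM//; first by rewrite divr_ge0 ?(ltW Dk'0)// subr_ge0.
  - by rewrite invr_ge0 ltW.
  - by rewrite ler_pdivrMr// mul1r; lra.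
  - by rewrite lef_pV2.
have lim s : exists l, 0 <= s -> forall k : nat, d0 + s < k%:R ->
    mdist (sg k s) l <= Num.sqrt (4 * d0 * s ^+ 2 / (k%:R - d0)).
  have [s0|_] := leP 0 s; last by exists p.
  pose K := (Num.truncn (d0 + s)).+1.
  have KP (k : nat) : (d0 + s < k%:R) = (K <= k)%N by rewrite truncn_lt_nat ?addr_ge0.
  have [|l lP] := @proper_complete _ _ (fun m => sg (K + m)%N s)
    (fun m => Num.sqrt (4 * d0 * s ^+ 2 / ((K + m)%N%:R - d0))) pX.
    by move=> m n mn; apply: est => //; rewrite ?leq_add2l// KP leq_addr.
  by exists l => _ k; rewrite KP => Kk; have := lP (k - K)%N; rewrite subnKC.
have [c cP] := choice lim.
have small s (eps : R) : 0 < eps -> exists k0 : nat, forall k : nat, (k0 <= k)%N ->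
    d0 + s < k%:R /\ Num.sqrt (4 * d0 * s ^+ 2 / (k%:R - d0)) <= eps.
  move=> e0; set B := 4 * d0 * s ^+ 2 / eps ^+ 2; pose A := d0 + `|s| + B.
  have B0 : 0 <= B.
    by rewrite divr_ge0 ?sqr_ge0// mulr_ge0 ?sqr_ge0// mulr_ge0.
  exists (Num.truncn A).+1 => k.
  have sn := ler_norm s; have sn0 : 0 <= `|s| := normr_ge0 s.
  have A0 : 0 <= A by rewrite /A !addr_ge0.
  rewrite truncn_lt_nat//.
  rewrite /A => kA; split; first lra.
  rewrite -[leRHS]ger0_norm ?(ltW e0)// -sqrtr_sqr ler_wsqrtr//.
  rewrite ler_pdivrMr; last lra.
  rewrite [leRHS]mulrC -ler_pdivrMr ?exprn_gt0// -/B; lra.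
exists c; split.
- move=> s t; rewrite /= !in_itv /= !andbT => s0 t0.
  have key (eps : R) : 0 < eps -> exists k, [/\ mdist (sg k s) (c s) <= eps,
      mdist (sg k t) (c t) <= eps & mdist (sg k s) (sg k t) = `|s - t|].
    move=> e0; have [k1 k1P] := small s _ e0; have [k2 k2P] := small t _ e0.
    have [sk se] := k1P _ (leq_maxl k1 k2); have [tk te] := k2P _ (leq_maxr k1 k2).
    exists (maxn k1 k2); split.
    + by rewrite (le_trans (cP _ s0 _ sk)).
    + by rewrite (le_trans (cP _ t0 _ tk)).
    + have [gk _ _] := sgP (maxn k1 k2); have Dk := Dlow (maxn k1 k2).
      by rewrite (geodesic_itvE gk)// -/(D _); lra.
  apply/eqP; rewrite eq_le; apply/andP; split; apply/ler_addgt0Pr => eps e0.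
    have [|k [sk tk <-]] := key (eps / 2); first lra.
    have t1 := metric_triangle (c s) (sg k s) (c t).
    have t2 := metric_triangle (sg k s) (sg k t) (c t).
    by rewrite (metric_sym (c s) (sg k s)) in t1; lra.
  have [|k [sk tk <-]] := key (eps / 2); first lra.
  have t1 := metric_triangle (sg k s) (c s) (sg k t).
  have t2 := metric_triangle (c s) (c t) (sg k t).
  by rewrite (metric_sym (c t) (sg k t)) in t2; lra.
- exists (2 * d0) => s s0; apply/ler_addgt0Pr => eps e0.
  have [k kP] := small s _ e0; have [sk se] := kP _ (leqnn _).
  have [gk ek fk] := sgP k; rewrite -/(D k) in gk fk; have Dk := Dlow k.
  have Dk0 : 0 < D k by lra.
  have lim_k := cP s s0 k sk.
  have k0 : (0 : R) < k%:R by lra.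
  have l01 : 0 <= s / D k <= 1 by apply: ratio_itv; lra.
  have := cat0_convex catX (geodesic_ray_itv (a := k%:R) rg) gk (ltW k0) (ltW Dk0) l01.
  rewrite divfK ?gt_eqF// fk mdistxx mulr0 addr0 ek => H.
  have : mdist (g s) (g (s / D k * k%:R)) <= (s / D k) * d0.
    rewrite geodesic_rayE// ?mulr_ge0 ?invr_ge0 ?(ltW Dk0)//.
    have -> : s - s / D k * k%:R = s / D k * (D k - k%:R) by field; rewrite gt_eqF.
    rewrite normrM ger0_norm; last by case/andP: l01.
    rewrite ler_wpM2l//; first by case/andP: l01.
    rewrite ler_norml; apply/andP; split; first lra.
    have := metric_triangle p (g 0) (g k%:R).
    by rewrite geodesic_rayE// sub0r normrN ger0_norm// -/d0 -/(D k); lra.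
  have : s / D k * d0 <= d0 by rewrite ler_piMl//; case/andP: l01.
  have t1 := metric_triangle (g s) (g (s / D k * k%:R)) (c s).
  have t2 := metric_triangle (g (s / D k * k%:R)) (sg k s) (c s).
  rewrite (metric_sym (g 0) p) -/d0 in H.
  move: H t1 t2 lim_k; move: (s / D k) => r H t1 t2 lim_k h1 h2.
  by lra.
- have [k kP] := small 0 _ ltr01; have [sk _] := kP _ (leqnn _).
  have := cP 0 (lexx _) k sk; rewrite expr0n mulr0 mul0r sqrtr0.
  have [_ -> _] := sgP k => H.
  by apply/esym/mdist_positivity/eqP; rewrite eq_le H mdist_ge0.
Qed.

End Asymptotic.

(** * Angles between rays *)

Section Trigonometry.
Context {R : realType}.

Lemma ler_acos (x y : R) : -1 <= x <= 1 -> -1 <= y <= 1 -> x <= y -> acos y <= acos x.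
Proof.
move=> x1 y1 xy; rewrite leNgt; apply/negP => lt.
have := lt; rewrite -ltr_cos ?in_itv /= ?acos_ge0 ?acos_lepi// !acosK ?in_itv//=.
by rewrite ltNge xy.
Qed.

Lemma ler_cos (x y : R) : 0 <= x <= pi -> 0 <= y <= pi -> x <= y -> cos y <= cos x.
Proof.
move=> x1 y1; rewrite le_eqVlt => /orP[/eqP ->//|xy].
by rewrite ltW// ltr_cos.
Qed.

Lemma cos_lip (x y : R) : x <= y -> cos x - cos y <= y - x.
Proof.
move=> xy; have [|z _ e] := @MVT_segment R (fun z => cos z) (fun z => - sin z) x y xy.
  by apply: continuous_subspaceT => z; exact: continuous_cos.
rewrite -opprB e mulNr opprK ler_piMl// ?subr_ge0//.
Qed.

Lemma cos_ge_pihalf (x d : R) : 0 <= d -> 0 <= x -> x <= pi / 2 + d -> - d <= cos x.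
Proof.
move=> d0 x0 xd; have [xp|px] := leP x (pi / 2).
  apply: (@le_trans _ _ 0); first by rewrite oppr_le0.
  by apply: cos_ge0_pihalf; rewrite xp andbT (le_trans _ x0)// oppr_le0 divr_ge0 ?pi_ge0.
by have := cos_lip (ltW px); rewrite cos_pihalf; lra.
Qed.

Lemma cos_add_pi (x y d : R) : 0 <= d -> 0 <= x <= pi -> 0 <= y <= pi -> pi - d <= x + y ->
  cos x + cos y <= d.
Proof.
move=> d0 x0 y0 xy; have h : 0 <= pi - y <= pi by lra.
have cpy : cos (pi - y) = - cos y by rewrite addrC cosDpi cosN.
have [xy'|yx] := leP x (pi - y).
  by have := cos_lip xy'; rewrite cpy; lra.
by have := ler_cos h x0 (ltW yx); rewrite cpy; lra.
Qed.

End Trigonometry.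

Section Angles.
Context {R : realType} {X : metricType R}.
Hypothesis catX : CAT0 X.
Implicit Types c : R -> X.

(** The cosine of the comparison angle, by the law of cosines. *)
Definition kappa c1 c2 (s t : R) : R :=
  (s ^+ 2 + t ^+ 2 - mdist (c1 s) (c2 t) ^+ 2) / (2 * s * t).

Lemma kappa_sym c1 c2 s t : kappa c1 c2 s t = kappa c2 c1 t s.
Proof. by rewrite /kappa metric_sym (addrC (s ^+ 2)) mulrAC. Qed.

Lemma comparison_angleE c1 c2 s t : geodesic_ray c1 -> geodesic_ray c2 -> c1 0 = c2 0 ->
  0 < s -> 0 < t -> comparison_angle (c1 0) (c1 s) (c2 t) = acos (kappa c1 c2 s t).
Proof.
move=> r1 r2 e s0 t0; rewrite /comparison_angle {2 4}e !geodesic_rayE ?(ltW s0) ?(ltW t0)//.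
by rewrite !sub0r !normrN !gtr0_norm.
Qed.

Lemma kappa_itv c1 c2 s t : geodesic_ray c1 -> geodesic_ray c2 -> c1 0 = c2 0 ->
  0 < s -> 0 < t -> -1 <= kappa c1 c2 s t <= 1.
Proof.
move=> r1 r2 e s0 t0.
have d1 : mdist (c1 0) (c1 s) = s by rewrite geodesic_rayE ?(ltW s0)// sub0r normrN gtr0_norm.
have d2 : mdist (c1 0) (c2 t) = t by rewrite e geodesic_rayE ?(ltW t0)// sub0r normrN gtr0_norm.
have t1 := metric_triangle (c1 s) (c1 0) (c2 t); rewrite (metric_sym (c1 s) (c1 0)) d1 d2 in t1.
have t2 := metric_triangle (c1 0) (c1 s) (c2 t); rewrite d1 d2 in t2.
have t3 := metric_triangle (c1 0) (c2 t) (c1 s); rewrite d1 d2 (metric_sym (c2 t)) in t3.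
have D0 := mdist_ge0 (c1 s) (c2 t).
have st : 0 < 2 * s * t by rewrite !mulr_gt0.
rewrite /kappa ler_pdivlMr// ler_pdivrMr//; set D := mdist _ _ in t1 t2 t3 D0 *.
apply/andP; split; rewrite -subr_ge0.
  have -> : s ^+ 2 + t ^+ 2 - D ^+ 2 - -1 * (2 * s * t) = (s + t - D) * (s + t + D) by ring.
  by rewrite mulr_ge0//; lra.
have -> : 1 * (2 * s * t) - (s ^+ 2 + t ^+ 2 - D ^+ 2) = (D - (s - t)) * (D + (s - t)) by ring.
by rewrite mulr_ge0//; lra.
Qed.

(** This is the hinge inequality divided by 2 * s * t: comparison angles
    shrink towards the vertex. *)
Lemma kappa_mono c1 c2 s t s' t' : geodesic_ray c1 -> geodesic_ray c2 -> c1 0 = c2 0 ->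
  0 < s -> 0 < t -> s <= s' -> t <= t' -> kappa c1 c2 s' t' <= kappa c1 c2 s t.
Proof.
move=> r1 r2 e s0 t0 ss' tt'.
have s'0 : 0 < s' by lra.
have t'0 : 0 < t' by lra.
have l1 : 0 <= s / s' <= 1 by apply: ratio_itv; lra.
have l2 : 0 <= t / t' <= 1 by apply: ratio_itv; lra.
have := hinge catX (geodesic_ray_itv (a := s') r1) (geodesic_ray_itv (a := t') r2) e
  (ltW s'0) (ltW t'0) l1 l2.
rewrite !divfK ?gt_eqF// => H.
rewrite /kappa -subr_ge0.
have -> : (s ^+ 2 + t ^+ 2 - mdist (c1 s) (c2 t) ^+ 2) / (2 * s * t) -
   (s' ^+ 2 + t' ^+ 2 - mdist (c1 s') (c2 t') ^+ 2) / (2 * s' * t') =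
   ((s / s') ^+ 2 * s' ^+ 2 + (t / t') ^+ 2 * t' ^+ 2 -
      s / s' * (t / t') * (s' ^+ 2 + t' ^+ 2 - mdist (c1 s') (c2 t') ^+ 2) - mdist (c1 s) (c2 t) ^+ 2)
   / (2 * s * t).
  by field; rewrite !gt_eqF.
by rewrite divr_ge0 ?subr_ge0// ?mulr_ge0// ltW.
Qed.

(** By monotonicity the limit that defines the angle exists and equals the
    infimum of the comparison angles; the last clause says that every hinge
    close to the vertex is almost as narrow as the angle. *)
Lemma angle_betweenP c1 c2 : geodesic_ray c1 -> geodesic_ray c2 -> c1 0 = c2 0 ->
  let a := angle_between c1 c2 in
  [/\ 0 <= a <= pi,
      forall s t, 0 < s -> 0 < t -> a <= acos (kappa c1 c2 s t) &
      forall eps, 0 < eps -> exists2 r, 0 < r & forall s t, 0 < s <= r -> 0 < t <= r ->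
        acos (kappa c1 c2 s t) < a + eps].
Proof.
move=> r1 r2 e /=.
pose S := [set a | exists s t, [/\ 0 < s, 0 < t & a = acos (kappa c1 c2 s t)]].
have kI s t : 0 < s -> 0 < t -> -1 <= kappa c1 c2 s t <= 1 by exact: kappa_itv.
have S11 : S (acos (kappa c1 c2 1 1)) by exists 1, 1; rewrite ltr01.
have Slb : lbound S 0 by move=> _ [s [t [s0 t0 ->]]]; rewrite acos_ge0// kI.
have Sinf : has_inf S by split; [exists (acos (kappa c1 c2 1 1))|exists 0].
have i_le s t : 0 < s -> 0 < t -> inf S <= acos (kappa c1 c2 s t).
  by move=> s0 t0; apply: ge_inf; [exists 0|exists s, t].
have i_near eps : 0 < eps -> exists2 r, 0 < r & forall s t, 0 < s <= r -> 0 < t <= r ->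
        acos (kappa c1 c2 s t) < inf S + eps.
  move=> e0; have [_ [s0 [t0 [s00 t00 ->]]] lt] := inf_adherent e0 Sinf.
  exists (Num.min s0 t0); first by rewrite lt_min s00.
  move=> s t /andP[s1]; rewrite le_min => /andP[ss0 _] /andP[t1]; rewrite le_min => /andP[_ tt0].
  by apply: le_lt_trans lt; apply: ler_acos; rewrite ?kI//; apply: kappa_mono.
have -> : angle_between c1 c2 = inf S.
  apply: cvg_lim; first exact: norm_hausdorff.
  apply/cvgrPdist_le => eps e0; have [r r0 rP] := i_near _ e0.
  exists ([set s | 0 < s <= r], [set s | 0 < s <= r]).
    have n : \forall z \near (0 : R)^'+, 0 < z <= r.
      by near=> z; apply/andP; split; near: z; [exact: nbhs_right_gt|exact: nbhs_right_le].
    by split.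
  move=> [s t] /= [s0r t0r]; have /andP[s0 _] := s0r; have /andP[t0 _] := t0r.
  rewrite comparison_angleE// distrC ger0_norm ?subr_ge0 ?i_le//.
  by rewrite lerBlDl ltW// rP.
split=> //; apply/andP; split; first by apply: lb_le_inf => //; exists (acos (kappa c1 c2 1 1)).
by rewrite (le_trans (i_le 1 1 _ _))// acos_lepi// kI.
Unshelve. all: by end_near. Qed.

Lemma angle_between_ext c1 c2 c1' c2' :
  geodesic_ray c1 -> geodesic_ray c2 -> c1 0 = c2 0 ->
  geodesic_ray c1' -> geodesic_ray c2' -> c1' 0 = c2' 0 ->
  (forall s t, 0 < s -> 0 < t -> mdist (c1 s) (c2 t) = mdist (c1' s) (c2' t)) ->
  angle_between c1 c2 = angle_between c1' c2'.
Proof.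
suff le (d1 d2 d1' d2' : R -> X) : geodesic_ray d1 -> geodesic_ray d2 -> d1 0 = d2 0 ->
    geodesic_ray d1' -> geodesic_ray d2' -> d1' 0 = d2' 0 ->
    (forall s t, 0 < s -> 0 < t -> mdist (d1 s) (d2 t) = mdist (d1' s) (d2' t)) ->
    angle_between d1 d2 <= angle_between d1' d2'.
  move=> r1 r2 e r1' r2' e' H; apply/eqP; rewrite eq_le !le// => s t s0 t0.
  by rewrite H.
move=> r1 r2 e r1' r2' e' H; apply/ler_addgt0Pr => eps e0.
have [_ lo _] := angle_betweenP r1 r2 e; have [_ _ up] := angle_betweenP r1' r2' e'.
have [r r0 rP] := up _ e0.
apply: (le_trans (lo r r r0 r0)); rewrite /kappa H//.
by apply/ltW/rP; rewrite r0 lexx.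
Qed.

Lemma angle_between_sym c1 c2 : geodesic_ray c1 -> geodesic_ray c2 -> c1 0 = c2 0 ->
  angle_between c1 c2 = angle_between c2 c1.
Proof.
suff le (d1 d2 : R -> X) : geodesic_ray d1 -> geodesic_ray d2 -> d1 0 = d2 0 ->
    angle_between d1 d2 <= angle_between d2 d1.
  by move=> r1 r2 e; apply/eqP; rewrite eq_le !le.
move=> r1 r2 e; apply/ler_addgt0Pr => eps e0.
have [_ lo _] := angle_betweenP r1 r2 e; have [_ _ up] := angle_betweenP r2 r1 (esym e).
have [r r0 rP] := up _ e0.
apply: (le_trans (lo r r r0 r0)); rewrite kappa_sym.
by apply/ltW/rP; rewrite r0 lexx.
Qed.

Lemma kappa_le_cos c1 c2 s t : geodesic_ray c1 -> geodesic_ray c2 -> c1 0 = c2 0 ->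
  0 < s -> 0 < t -> kappa c1 c2 s t <= cos (angle_between c1 c2).
Proof.
move=> r1 r2 e s0 t0; have [a0 lo _] := angle_betweenP r1 r2 e.
have k1 := kappa_itv r1 r2 e s0 t0.
rewrite -[leLHS](acosK (x := kappa c1 c2 s t)) ?in_itv//.
by apply: ler_cos; rewrite ?acos_ge0 ?acos_lepi ?lo.
Qed.

(** In a triangle with two unit sides at angle a + b, the ray that divides
    this angle into a and b meets the third side at distance q from the vertex,
    with q = sin (a + b) / (sin a + sin b).  Both sides of the identity are the
    squared length of the part of the third side facing the angle a. *)
Lemma hinge_identity (a b : R) : sin a + sin b != 0 ->
  1 + (sin (a + b) / (sin a + sin b)) ^+ 2 - 2 * (sin (a + b) / (sin a + sin b)) * cos a
  = (sin a / (sin a + sin b)) ^+ 2 * (2 - 2 * cos (a + b)).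
Proof.
move=> S0; have h := cos2Dsin2 (a + b); have ha := cos2Dsin2 a.
have h1 : sin a + sin b - sin (a + b) * cos a = sin a * (1 - cos (a + b)).
  apply/eqP; rewrite -subr_eq0 sinD cosD; apply/eqP.
  transitivity (sin b * (1 - (cos a ^+ 2 + sin a ^+ 2))); first by ring.
  by rewrite ha subrr mulr0.
apply: (mulIf (x := (sin a + sin b) ^+ 2)); first by rewrite sqrf_eq0.
have -> : (1 + (sin (a + b) / (sin a + sin b)) ^+ 2 - 2 * (sin (a + b) / (sin a + sin b)) * cos a)
  * (sin a + sin b) ^+ 2 = (sin a + sin b - sin (a + b) * cos a) ^+ 2
    + sin (a + b) ^+ 2 * (1 - cos a ^+ 2) by field.
rewrite h1 -sin2cos2.
have -> : (sin a / (sin a + sin b)) ^+ 2 * (2 - 2 * cos (a + b)) * (sin a + sin b) ^+ 2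
  = sin a ^+ 2 * (1 - 2 * cos (a + b) + (cos (a + b) ^+ 2 + sin (a + b) ^+ 2)) by rewrite h; field.
ring.
Qed.

(** Alexandrov's argument.  In the plane put two vectors of the same small
    length t at angle a + b, where a and b slightly exceed the two angles.
    The segment between their ends, of length P, meets the ray at angle a at
    distance u = q * t.  The corresponding points on c1, c2 and c3 are no
    farther apart than in the plane, so mdist (c1 t) (c3 t) <= P, which
    bounds the comparison angle of c1 and c3 by a + b. *)
Lemma angle_between_triangle c1 c2 c3 : geodesic_ray c1 -> geodesic_ray c2 -> geodesic_ray c3 ->
  c1 0 = c2 0 -> c2 0 = c3 0 ->
  angle_between c1 c3 <= angle_between c1 c2 + angle_between c2 c3.
Proof.
move=> r1 r2 r3 e12 e23; have e13 := etrans e12 e23.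
have [/andP[p0 pP] lo _] := angle_betweenP r1 r3 e13.
have [/andP[q0 qP] _ up12] := angle_betweenP r1 r2 e12.
have [/andP[w0 wP] _ up23] := angle_betweenP r2 r3 e23.
apply/ler_addgt0Pr => eps' e'0.
pose eps := eps' / 2.
have e0 : 0 < eps by rewrite /eps; lra.
rewrite (_ : eps' = eps + eps); last by rewrite /eps; field.
pose a := angle_between c1 c2 + eps; pose b := angle_between c2 c3 + eps.
rewrite (_ : _ + _ + (eps + eps) = a + b); last by rewrite /a /b; ring.
have [piab|abpi] := leP pi (a + b); first exact: le_trans piab.
have a0 : 0 < a by rewrite /a; lra.
have b0 : 0 < b by rewrite /b; lra.
have sa : 0 < sin a by apply: sin_gt0_pi; lra.
have sb : 0 < sin b by apply: sin_gt0_pi; lra.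
have sab : 0 < sin (a + b) by apply: sin_gt0_pi; lra.
pose S := sin a + sin b.
have S0 : 0 < S by rewrite /S addr_gt0.
pose q := sin (a + b) / S.
have q_gt0 : 0 < q by rewrite divr_gt0.
have q1 : q <= 1.
  rewrite ler_pdivrMr// mul1r /S sinD lerD//.
    by rewrite ler_piMr ?cos_le1// ltW.
  by rewrite mulrC ler_piMr ?cos_le1// ltW.
have [r12 r120 P12] := up12 _ e0; have [r23 r230 P23] := up23 _ e0.
pose t := Num.min r12 r23.
have t0 : 0 < t by rewrite lt_min r120.
have t12 : t <= r12 by rewrite ge_min lexx.
have t23 : t <= r23 by rewrite ge_min lexx orbT.
pose u := q * t.
have u0 : 0 < u by rewrite mulr_gt0.
have ut : u <= t by rewrite ler_piMl// ltW.
have bound c d x y w : geodesic_ray c -> geodesic_ray d -> c 0 = d 0 -> 0 < x -> 0 < y ->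
    0 <= w <= pi -> acos (kappa c d x y) <= w ->
    mdist (c x) (d y) ^+ 2 <= x ^+ 2 + y ^+ 2 - 2 * x * y * cos w.
  move=> rc rd ecd x0 y0 w1 kw; have kI := kappa_itv rc rd ecd x0 y0.
  have : cos w <= kappa c d x y.
    rewrite -[leRHS](acosK (x := kappa c d x y)) ?in_itv//.
    by apply: ler_cos; rewrite ?acos_ge0 ?acos_lepi.
  by rewrite /kappa ler_pdivlMr ?mulr_gt0//; lra.
pose P2 := t ^+ 2 * (2 - 2 * cos (a + b)).
have P20 : 0 <= P2 by rewrite mulr_ge0 ?sqr_ge0//; have := cos_le1 (a + b); lra.
pose P := Num.sqrt P2.
have PE : P ^+ 2 = P2 by rewrite sqr_sqrtr.
have P0 : 0 <= P by apply: sqrtr_ge0.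
have d12 : mdist (c1 t) (c2 u) <= sin a / S * P.
  rewrite -(@ler_pXn2r _ 2)// ?nnegrE ?mdist_ge0 ?mulr_ge0 ?invr_ge0 ?(ltW sa) ?(ltW S0)//.
  apply: (le_trans (bound _ _ _ _ a r1 r2 e12 t0 u0 _ _)).
  - lra.
  - by apply/ltW/P12; rewrite ?t0 ?u0 ?t12//= (le_trans ut).
  rewrite [leRHS]exprMn PE /P2 /u le_eqVlt; apply/orP; left; apply/eqP.
  have -> : t ^+ 2 + (q * t) ^+ 2 - 2 * t * (q * t) * cos a
     = t ^+ 2 * (1 + q ^+ 2 - 2 * q * cos a) by ring.
  by rewrite /q /S hinge_identity ?gt_eqF//; ring.
have d23 : mdist (c2 u) (c3 t) <= sin b / S * P.
  rewrite -(@ler_pXn2r _ 2)// ?nnegrE ?mdist_ge0 ?mulr_ge0 ?invr_ge0 ?(ltW sb) ?(ltW S0)//.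
  apply: (le_trans (bound _ _ _ _ b r2 r3 e23 u0 t0 _ _)).
  - lra.
  - by apply/ltW/P23; rewrite ?t0 ?u0 ?t23//= (le_trans ut).
  rewrite [leRHS]exprMn PE /P2 /u le_eqVlt; apply/orP; left; apply/eqP.
  have -> : (q * t) ^+ 2 + t ^+ 2 - 2 * (q * t) * t * cos b
     = t ^+ 2 * (1 + q ^+ 2 - 2 * q * cos b) by ring.
  by rewrite /q /S (addrC a) (addrC (sin a)) hinge_identity ?gt_eqF ?addr_gt0//; ring.
have d13 : mdist (c1 t) (c3 t) <= P.
  rewrite (le_trans (metric_triangle _ (c2 u) _))// (le_trans (lerD d12 d23))//.
  by rewrite -mulrDl -mulrDl divff ?gt_eqF// mul1r.
apply: (le_trans (lo t t t0 t0)).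
have ab : 0 <= a + b <= pi by lra.
rewrite -[leRHS](cosK (x := a + b)) ?in_itv//.
apply: ler_acos; rewrite ?cos_geN1 ?cos_le1 ?kappa_itv//.
rewrite /kappa ler_pdivlMr ?mulr_gt0//.
have : mdist (c1 t) (c3 t) ^+ 2 <= P2 by rewrite -PE ler_pXn2r// nnegrE mdist_ge0.
by rewrite /P2; lra.
Qed.

Lemma angle_between_line (l : R -> X) : geodesic_line l ->
  angle_between l (fun t => l (- t)) = pi.
Proof.
move=> ll; have r1 := geodesic_line_ray ll; have r2 := geodesic_line_ray (geodesic_line_rev ll).
have e : l 0 = l (- 0) by rewrite oppr0.
have [/andP[_ ap] lo up] := angle_betweenP r1 r2 e.
apply/eqP; rewrite eq_le ap /=; apply/ler_addgt0Pr => eps e0.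
have [r r0 rP] := up _ e0; have := rP r r; rewrite r0 lexx => /(_ isT isT).
have -> : kappa l (fun t => l (- t)) r r = -1.
  rewrite /kappa ll opprK (ger0_norm (x := r + r)) ?addr_ge0 ?(ltW r0)//.
  by field; rewrite gt_eqF.
by rewrite acosN1 => /ltW.
Qed.

End Angles.

(** * The boundary at infinity and Busemann functions *)

Section Boundary.
Context {R : realType} {X : metricType R}.
Hypotheses (catX : CAT0 X) (pX : proper_space X).
Implicit Types (c : R -> X) (p x : X) (xi eta zeta : set (R -> X)).

Lemma endpoint_boundary c : geodesic_ray c -> ideal_boundary (endpoint c).
Proof. by move=> rc; exists c. Qed.

Lemma endpoint_self c : geodesic_ray c -> endpoint c c.
Proof. by move=> rc; split => //; exact: asymptotic_refl. Qed.

Lemma boundary_ray xi c : ideal_boundary xi -> xi c -> geodesic_ray c.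
Proof. by move=> [g rg <-] []. Qed.

Lemma boundary_asymptotic xi c c' : ideal_boundary xi -> xi c -> xi c' -> asymptotic c c'.
Proof.
move=> [g rg <-] [_ gc] [_ gc'].
exact: (asymptotic_trans (asymptotic_sym gc) gc').
Qed.

Lemma boundary_mem xi c c' : ideal_boundary xi -> xi c -> geodesic_ray c' ->
  asymptotic c c' -> xi c'.
Proof. by move=> [g rg <-] [_ gc] rc' cc'; split=> //; exact: asymptotic_trans cc'. Qed.

Lemma ray_fromP p xi : ideal_boundary xi ->
  [/\ geodesic_ray (ray_from p xi), xi (ray_from p xi) & ray_from p xi 0 = p].
Proof.
move=> bxi; have [g rg gxi] := bxi.
have [c [rc gc c0]] := asymptotic_ray_from catX pX p rg.
have xic : xi c by rewrite -gxi.
have [H1 H2] : [set c | xi c /\ c 0 = p] (ray_from p xi) by apply: (@xgetI _ _ _ c).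
by split=> //; apply: (boundary_ray bxi).
Qed.

Lemma ray_from_eq p xi c : ideal_boundary xi -> xi c -> c 0 = p ->
  forall t, 0 <= t -> ray_from p xi t = c t.
Proof.
move=> bxi xic c0; have [r1 xi1 r0] := ray_fromP p bxi.
apply: asymptotic_eq => //; first exact: (boundary_ray bxi).
  exact: (boundary_asymptotic bxi).
by rewrite r0.
Qed.

Lemma angle_atE p xi eta c1 c2 : ideal_boundary xi -> ideal_boundary eta ->
  xi c1 -> eta c2 -> c1 0 = p -> c2 0 = p ->
  angle_at p xi eta = angle_between c1 c2.
Proof.
move=> bxi beta xi1 eta2 e1 e2.
have [r1 x1 o1] := ray_fromP p bxi; have [r2 x2 o2] := ray_fromP p beta.
apply: angle_between_ext => //; rewrite ?o1 ?o2 ?e1 ?e2//.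
- exact: (boundary_ray bxi).
- exact: (boundary_ray beta).
- move=> s t s0 t0.
  by rewrite (ray_from_eq bxi xi1 e1 (ltW s0)) (ray_from_eq beta eta2 e2 (ltW t0)).
Qed.

Lemma angle_at_itv p xi eta : ideal_boundary xi -> ideal_boundary eta ->
  0 <= angle_at p xi eta <= pi.
Proof.
move=> bxi beta.
have [r1 x1 o1] := ray_fromP p bxi; have [r2 x2 o2] := ray_fromP p beta.
by have [] := angle_betweenP catX r1 r2 (etrans o1 (esym o2)).
Qed.

Lemma angle_at_sym p xi eta : ideal_boundary xi -> ideal_boundary eta ->
  angle_at p xi eta = angle_at p eta xi.
Proof.
move=> bxi beta.
have [r1 x1 o1] := ray_fromP p bxi; have [r2 x2 o2] := ray_fromP p beta.
by apply: angle_between_sym; rewrite ?o1 ?o2.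
Qed.

Lemma angle_at_triangle p xi eta zeta :
  ideal_boundary xi -> ideal_boundary eta -> ideal_boundary zeta ->
  angle_at p xi zeta <= angle_at p xi eta + angle_at p eta zeta.
Proof.
move=> bxi beta bzeta; have [r1 x1 o1] := ray_fromP p bxi.
have [r2 x2 o2] := ray_fromP p beta; have [r3 x3 o3] := ray_fromP p bzeta.
by apply: angle_between_triangle; rewrite ?o1 ?o2 ?o3.
Qed.

Lemma angle_at_le p xi eta : ideal_boundary xi -> ideal_boundary eta ->
  angle_at p xi eta <= angle xi eta.
Proof.
move=> bxi beta; apply: ub_le_sup; last by exists p.
by exists pi => _ [q _ <-]; have /andP[] := angle_at_itv q bxi beta.
Qed.

(** The two half-lines of l at l a are asymptotic to the two half-lines of l
    at l 0. *)
Lemma angle_at_line (l : R -> X) a xi zeta : geodesic_line l ->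
  ideal_boundary xi -> ideal_boundary zeta ->
  xi l -> zeta (fun t => l (- t)) -> angle_at (l a) xi zeta = pi.
Proof.
move=> ll bxi bzeta xil zetal.
rewrite -(angle_between_line catX (geodesic_line_shift a ll)).
apply: angle_atE; rewrite ?oppr0 ?addr0//.
  apply: (boundary_mem bxi xil); first exact: geodesic_line_ray (geodesic_line_shift a ll).
  by exists `|a| => t t0; rewrite ll; rewrite (_ : _ - _ = - a) ?normrN//; ring.
apply: (boundary_mem bzeta zetal).
  exact: geodesic_line_ray (geodesic_line_rev (geodesic_line_shift a ll)).
by exists `|a| => t t0; rewrite ll; rewrite (_ : _ - _ = - a) ?normrN//; ring.
Qed.

End Boundary.

Section Busemann.
Context {R : realType} {X : metricType R}.
Hypotheses (catX : CAT0 X) (pX : proper_space X).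
Implicit Types (c g : R -> X) (p x : X).

(** The function t |-> mdist x (g t) - t is nonincreasing and bounded below,
    so the limit is its infimum. *)
Lemma busemannP g x : geodesic_ray g ->
  (forall t, 0 <= t -> busemann g x <= mdist x (g t) - t) /\
  (forall eps, 0 < eps -> exists T, forall t, T <= t -> mdist x (g t) - t <= busemann g x + eps).
Proof.
move=> rg; pose S := [set mdist x (g t) - t | t in [set t | 0 <= t]].
have lb : lbound S (- mdist x (g 0)).
  move=> _ [t /= t0 <-]; have := metric_triangle (g 0) x (g t).
  by rewrite geodesic_rayE// sub0r normrN ger0_norm// (metric_sym _ x); lra.
have Sinf : has_inf S by split; [exists (mdist x (g 0) - 0), 0 => //=|exists (- mdist x (g 0))].
have lo t : 0 <= t -> inf S <= mdist x (g t) - t.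
  by move=> t0; apply: ge_inf; [exists (- mdist x (g 0))|exists t].
have up eps : 0 < eps -> exists T, forall t, T <= t -> mdist x (g t) - t <= inf S + eps.
  move=> e0; have [_ [T /= T0 <-] lt] := inf_adherent e0 Sinf.
  exists T => t Tt; apply: le_trans (ltW lt).
  have := metric_triangle x (g T) (g t).
  by rewrite (geodesic_rayE rg T0) ?(le_trans T0)// distrC ger0_norm ?subr_ge0//; lra.
suff -> : busemann g x = inf S by [].
apply: cvg_lim; first exact: norm_hausdorff.
apply/cvgrPdist_le => eps e0; have [T TP] := up _ e0.
near=> t; have t0 : 0 <= t by near: t; exact: nbhs_pinfty_ge.
rewrite distrC ger0_norm ?subr_ge0 ?lo// lerBlDl TP//.
Unshelve. all: by end_near. Qed.

Lemma busemann_lip g x y : geodesic_ray g -> busemann g x - busemann g y <= mdist x y.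
Proof.
move=> rg; have [lo _] := busemannP x rg; have [_ up] := busemannP y rg.
apply/ler_addgt0Pr => eps e0; have [T TP] := up _ e0.
pose t := Num.max T 0.
have t0 : 0 <= t by rewrite le_max lexx orbT.
have := TP t; rewrite le_max lexx => /(_ isT) h1; have h2 := lo t t0.
by have := metric_triangle x y (g t); lra.
Qed.

Lemma busemann_convex g c a l : geodesic_ray g -> geodesic_on `[0, a] c -> 0 <= a -> 0 <= l <= 1 ->
  busemann g (c (l * a)) <= (1 - l) * busemann g (c 0) + l * busemann g (c a).
Proof.
move=> rg gc a0 l01; have /andP[l0 l1] := l01.
have [lo _] := busemannP (c (l * a)) rg.
have [_ up0] := busemannP (c 0) rg; have [_ up1] := busemannP (c a) rg.
apply/ler_addgt0Pr => eps e0; have [T0 T0P] := up0 _ e0; have [T1 T1P] := up1 _ e0.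
pose t := Num.max T0 (Num.max T1 0).
have t0 : 0 <= t by rewrite !le_max lexx !orbT.
have h0 : mdist (c 0) (g t) - t <= busemann g (c 0) + eps by apply: T0P; rewrite le_max lexx.
have h1 : mdist (c a) (g t) - t <= busemann g (c a) + eps by apply: T1P; rewrite !le_max lexx orbT.
have h := lo t t0.
have k := cat0_convex_point catX (g t) gc a0 l01.
have l1' : 0 <= 1 - l by lra.
have := ler_wpM2l l1' h0; have := ler_wpM2l l0 h1.
by lra.
Qed.

(** Along c the function busemann g (c t) + t is nondecreasing because
    busemann g is 1-Lipschitz, and it is convex and bounded above because c
    stays close to g; so it is constant. *)
Lemma busemann_asymptotic g c t : geodesic_ray g -> geodesic_ray c -> asymptotic g c ->
  0 <= t -> busemann g (c t) = busemann g (c 0) - t.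
Proof.
move=> rg rc [M H] t0; apply/eqP; rewrite eq_le; apply/andP; split; last first.
  have := busemann_lip (c 0) (c t) rg; rewrite geodesic_rayE// sub0r normrN ger0_norm//; lra.
apply: (@le_add_inv _ _ _ (t * (M - busemann g (c 0))) t) => T tT T0.
have l01 : 0 <= t / T <= 1 by apply: ratio_itv; lra.
have /andP[l0 l1] := l01.
have := busemann_convex rg (geodesic_ray_itv (a := T) rc) (ltW T0) l01.
rewrite divfK ?gt_eqF// => /le_trans; apply.
have [lo _] := busemannP (g T) rg.
have := busemann_lip (c T) (g T) rg.
have := H T (ltW T0); rewrite (metric_sym (g T)) => h1 h2.
have := lo T (ltW T0); rewrite mdistxx => h3.
have h4 : busemann g (c T) <= M - T by lra.
have -> : busemann g (c 0) - t + t * (M - busemann g (c 0)) / T =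
  (1 - t / T) * busemann g (c 0) + t / T * (M - T) by field; rewrite gt_eqF.
by rewrite lerD2l ler_wpM2l.
Qed.

(** Up to a constant the two Busemann functions are equal.  The direction
    proved here rests on opp, which comes from the quadrilateral with vertices
    g 0, g T, c T and c 0: two opposite sides have length T and the other two
    are bounded, so the sum of its diagonals exceeds 2 * T by at most
    O(1 / T). *)
Lemma busemann_asymptotic_diff g c x : geodesic_ray g -> geodesic_ray c -> asymptotic g c ->
  busemann c x <= busemann g x - busemann g (c 0).
Proof.
move=> rg rc gc; have [M H] := gc; have [lo _] := busemannP (c 0) rg; have [lo' _] := busemannP (g 0) rc.
have opp : busemann g (c 0) + busemann c (g 0) <= 0.
  pose D := mdist (c 0) (g 0).
  apply: (@le_add_inv _ _ _ ((M ^+ 2 + D ^+ 2) / 2) 0) => T T0 _; rewrite add0r.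
  have := cat0_quad catX (g 0) (g T) (c T) (c 0).
  have -> : mdist (g 0) (g T) = T by rewrite geodesic_rayE ?(ltW T0)// sub0r normrN gtr0_norm.
  have -> : mdist (c T) (c 0) = T by rewrite geodesic_rayE ?(ltW T0)// subr0 gtr0_norm.
  rewrite -/D => q.
  have M2 : mdist (g T) (c T) ^+ 2 <= M ^+ 2.
    have h := H T (ltW T0); have h0 := mdist_ge0 (g T) (c T).
    by rewrite ler_pXn2r// nnegrE (le_trans h0).
  pose u := mdist (c 0) (g T) - T; pose v := mdist (g 0) (c T) - T.
  have uE : mdist (g T) (c 0) = T + u by rewrite /u metric_sym; ring.
  have vE : mdist (g 0) (c T) = T + v by rewrite /v; ring.
  rewrite uE vE in q.
  have uv : busemann g (c 0) + busemann c (g 0) <= u + v by rewrite lerD ?lo ?lo' ?(ltW T0).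
  rewrite (le_trans uv)// ler_pdivlMr//.
  have := sqr_ge0 u; have := sqr_ge0 v; lra.
suff : busemann c x - busemann c (g 0) <= busemann g x by lra.
have [_ up] := busemannP x rg.
apply/ler_addgt0Pr => eps e0; have [T TP] := up _ e0.
pose t := Num.max T 0.
have t0 : 0 <= t by rewrite le_max lexx orbT.
have := TP t; rewrite le_max lexx => /(_ isT) h1.
have := busemann_asymptotic rc rg (asymptotic_sym gc) t0.
by have := busemann_lip x (g t) rc; lra.
Qed.

(** By monotonicity of comparison angles every triangle with vertex g 0 is at
    least as wide as the Euclidean one with angle angle_between g c, in which
    the side facing the vertex is at least the projection T - t * C. *)
Lemma busemann_angle_between g c t : geodesic_ray g -> geodesic_ray c -> g 0 = c 0 ->
  0 < t -> - (t * cos (angle_between g c)) <= busemann g (c t).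
Proof.
move=> rg rc e t0; have [_ up] := busemannP (c t) rg.
apply/ler_addgt0Pr => eps e0; have [T0 T0P] := up _ e0.
set C := cos _; pose T := Num.max T0 (Num.max 1 (t * C)).
have T1 : 0 < T by rewrite !lt_max ltr01 orbT.
have TC : t * C <= T by rewrite !le_max lexx !orbT.
have := T0P T; rewrite le_max lexx => /(_ isT); apply: le_trans.
have k : kappa g c T t <= C := kappa_le_cos catX rg rc e T1 t0.
have C2 : C ^+ 2 <= 1 by rewrite -(cos2Dsin2 (angle_between g c)) lerDl sqr_ge0.
suff : T - t * C <= mdist (g T) (c t) by rewrite metric_sym; lra.
rewrite -(@ler_pXn2r _ 2)// ?nnegrE ?mdist_ge0 ?subr_ge0//.
move: k; rewrite /kappa ler_pdivrMr ?mulr_gt0// => k.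
have : t ^+ 2 * C ^+ 2 <= t ^+ 2 by rewrite ler_piMr ?sqr_ge0.
by rewrite sqrrB exprMn; lra.
Qed.

Lemma busemann_angle_ge g c t zeta : geodesic_ray g -> ideal_boundary zeta -> zeta c -> 0 <= t ->
  - (t * cos (angle_at (c 0) (endpoint g) zeta)) <= busemann g (c t) - busemann g (c 0).
Proof.
move=> rg bz zc; rewrite le_eqVlt => /orP[/eqP <-|t0]; first by rewrite mul0r oppr0 subrr.
have rc := boundary_ray bz zc; have bg := endpoint_boundary rg.
have [r1 x1 o1] := ray_fromP catX pX (c 0) bg.
rewrite (angle_atE catX pX bg bz x1 zc o1 erefl).
apply: (le_trans (busemann_angle_between r1 rc o1 t0)).
have := busemann_asymptotic_diff (c t) rg r1 (boundary_asymptotic bg (endpoint_self rg) x1).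
by rewrite o1.
Qed.

End Busemann.

(** * Strainers and their flows *)

Section Strainer.
Context {R : realType} {X : metricType R}.
Hypotheses (pX : proper_space X) (gcX : geodesically_complete X) (catX : CAT0 X).

(** Apply busemann_angle_ge to the reversed ray, which starts at c t and points
    to the opposite end z' of a line extending c; the angles to zeta and to z'
    at c t add up to at least pi. *)
Lemma busemann_angle_le (g c : R -> X) t (zeta : set (R -> X)) :
  geodesic_ray g -> ideal_boundary zeta -> zeta c -> 0 <= t ->
  busemann g (c t) - busemann g (c 0) <= - (t * cos (angle_at (c t) (endpoint g) zeta)).
Proof.
move=> rg bz zc t0; have rc := boundary_ray bz zc; have bg := endpoint_boundary rg.
have [l ll lc] := extend_ray catX gcX rc.
have rl := geodesic_line_ray ll.
have zl : zeta l.
  by apply: (boundary_mem bz zc) => //; exists 0 => s s0; rewrite lc// mdistxx.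
have rl' := geodesic_line_ray (geodesic_line_rev ll).
have bz' := endpoint_boundary rl'; have z'l := endpoint_self rl'.
set z' := endpoint _ in bz' z'l.
have rv : geodesic_ray (fun s => l (t - s)).
  exact: geodesic_line_ray (geodesic_line_rev (geodesic_line_shift t ll)).
have z'v : z' (fun s => l (t - s)).
  apply: (boundary_mem bz' z'l) => //.
  by exists `|t| => s s0; rewrite ll (_ : - s - (t - s) = - t) ?normrN//; ring.
have := busemann_angle_ge catX pX rg bz' z'v t0.
rewrite subrr subr0 lc// lc// => H.
have pi_le : pi - 0 <= angle_at (c t) (endpoint g) zeta + angle_at (c t) (endpoint g) z'.
  rewrite subr0 -(angle_at_line catX pX t ll bz bz' zl z'l) lc//.
  by rewrite (angle_at_sym catX pX (c t) bg bz) angle_at_triangle.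
have C := cos_add_pi (lexx 0) (angle_at_itv catX pX (c t) bg bz) (angle_at_itv catX pX (c t) bg bz') pi_le.
have := ler_wpM2l t0 C; rewrite mulr0 mulrDr; lra.
Qed.

Context {n : nat}.
Variables (delta : R) (g : 'I_n -> R -> X) (eta : 'I_n -> set (R -> X)).
Hypothesis delta0 : 0 < delta.
Hypothesis rg : forall j, geodesic_ray (g j).
Hypothesis beta : forall j, ideal_boundary (eta j).
Hypothesis opp : forall j, opposite_spherical delta (endpoint (g j)) (eta j).
Hypothesis orth : forall j k, j != k ->
  angle (endpoint (g j)) (endpoint (g k)) < pi / 2 + delta /\
  angle (endpoint (g j)) (eta k) < pi / 2 + delta.

Let xi j := endpoint (g j).
Let bxi j : ideal_boundary (xi j). Proof. exact: endpoint_boundary. Qed.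
Let b j := busemann (g j).

(** Extend the ray from p to xi j backwards to a point z' at infinity.  Then
    angle (xi j) z' is pi, so that z' is delta-close to eta j by the definition
    of opposite spherical points, and so at p. *)
Lemma strainer_antipodal p j : pi - delta <= angle_at p (xi j) (eta j).
Proof.
have [r xr r0] := ray_fromP catX pX p (bxi j).
set c := ray_from _ _ in r xr r0.
have [l ll lc] := extend_ray catX gcX r.
have rl' := geodesic_line_ray (geodesic_line_rev ll).
have bz' := endpoint_boundary rl'; have z'l := endpoint_self rl'.
set z' := endpoint _ in bz' z'l.
have xl : xi j l.
  apply: (boundary_mem (bxi j) xr); first exact: geodesic_line_ray.
  by exists 0 => s s0; rewrite lc// mdistxx.
have := angle_at_line catX pX 0 ll (bxi j) bz' xl z'l; rewrite lc// r0 => e.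
have h1 := angle_at_le catX pX p (bxi j) bz'.
have h2 := angle_at_le catX pX p bz' (beta j).
have h3 := opp j bz'.
have h4 := angle_at_triangle catX pX p (bxi j) (beta j) bz'.
by rewrite (angle_at_sym catX pX p (beta j) bz') in h4; lra.
Qed.

Lemma strainer_cos p j zeta : ideal_boundary zeta ->
  cos (angle_at p (xi j) zeta) + cos (angle_at p (eta j) zeta) <= delta.
Proof.
move=> bz; apply: cos_add_pi; rewrite ?(ltW delta0) ?(angle_at_itv catX pX)//.
apply: (le_trans (strainer_antipodal p j)).
by rewrite (angle_at_sym catX pX p (beta j) bz) angle_at_triangle.
Qed.

(** The upper bounds on angles bound the cosines from below, and strainer_cos
    converts a lower bound at one of the directions xi j and eta j into an
    upper bound at the other. *)
Lemma strainer_cos_orth p i j : i != j ->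
  - delta <= cos (angle_at p (xi i) (xi j)) <= 2 * delta /\
  - delta <= cos (angle_at p (xi i) (eta j)) <= 2 * delta.
Proof.
move=> ij; have [h1 h2] := orth ij; have d0 := ltW delta0.
have /andP[a0 _] := angle_at_itv catX pX p (bxi i) (bxi j).
have /andP[a0' _] := angle_at_itv catX pX p (bxi i) (beta j).
have c1 := cos_ge_pihalf d0 a0 (le_trans (angle_at_le catX pX p (bxi i) (bxi j)) (ltW h1)).
have c2 := cos_ge_pihalf d0 a0' (le_trans (angle_at_le catX pX p (bxi i) (beta j)) (ltW h2)).
have := strainer_cos p j (bxi i).
by rewrite (angle_at_sym catX pX p (bxi j) (bxi i)) (angle_at_sym catX pX p (beta j) (bxi i)); lra.
Qed.

(** Flowing from p for the time - t towards xi j, or for the time t towards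
    eta j, changes b j by nearly t and the other coordinates little. *)
Definition strainer_flow j t p : X :=
  if t <= 0 then ray_from p (xi j) (- t) else ray_from p (eta j) t.

Lemma busemann_ray_bound i p (zeta : set (R -> X)) (u v t : R) : ideal_boundary zeta ->
  (forall q, u <= cos (angle_at q (xi i) zeta) <= v) -> 0 <= t ->
  - (t * v) <= b i (ray_from p zeta t) - b i p <= - (t * u).
Proof.
move=> bz uv t0; have [r z r0] := ray_fromP catX pX p bz.
have h1 := busemann_angle_ge catX pX (rg i) bz z t0.
have h2 := busemann_angle_le (rg i) bz z t0.
rewrite r0 in h1 h2.
have /andP[_ c1] := uv p; have /andP[c2 _] := uv (ray_from p zeta t).
have m1 := ler_wpM2l t0 c1; have m2 := ler_wpM2l t0 c2.
by rewrite /b; lra.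
Qed.

Lemma strainer_flow_busemann i j t p :
  `|b i (strainer_flow j t p) - b i p - (i == j)%:R * t| <= 2 * delta * `|t|.
Proof.
have d0 := ltW delta0.
rewrite /strainer_flow; have [t0|t0] := leP t 0.
  have nt : 0 <= - t by rewrite oppr_ge0.
  rewrite (ler0_norm t0); have [->|ij] := eqVneq i j.
    have [r z r0] := ray_fromP catX pX p (bxi j).
    rewrite /b (busemann_asymptotic catX (rg j) r _ nt).
      by rewrite r0 mul1r opprK (_ : _ - _ = 0) ?normr0 ?mulr_ge0//; ring.
    exact: boundary_asymptotic (bxi j) (endpoint_self (rg j)) z.
  have := busemann_ray_bound p (bxi j) (fun q => (strainer_cos_orth q ij).1) nt.
  rewrite mul0r subr0 ler_norml => /andP[h1 h2].
  by have := mulr_ge0 nt d0; lra.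
have tn := ltW t0.
rewrite (ger0_norm tn); have [->|ij] := eqVneq i j.
  have uv q : -1 <= cos (angle_at q (xi j) (eta j)) <= -1 + delta.
    rewrite cos_geN1 /=; have := strainer_antipodal q j => h.
    have /andP[_ a] := angle_at_itv catX pX q (bxi j) (beta j).
    by have := cos_lip a; rewrite cospi; lra.
  have := busemann_ray_bound p (beta j) uv tn.
  rewrite mul1r ler_norml => /andP[h1 h2].
  by have := mulr_ge0 tn d0; lra.
have := busemann_ray_bound p (beta j) (fun q => (strainer_cos_orth q ij).2) tn.
rewrite mul0r subr0 ler_norml => /andP[h1 h2].
by have := mulr_ge0 tn d0; lra.
Qed.

Lemma strainer_flow0 j p : strainer_flow j 0 p = p.
Proof. by rewrite /strainer_flow lexx oppr0; have [_ _ ->] := ray_fromP catX pX p (bxi j). Qed.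

Let ray_from_lip (zeta : set (R -> X)) (p q : X) (t : R) : ideal_boundary zeta -> 0 <= t ->
  mdist (ray_from p zeta t) (ray_from q zeta t) <= mdist p q.
Proof.
move=> bz t0; have [r z r0] := ray_fromP catX pX p bz; have [r' z' r0'] := ray_fromP catX pX q bz.
by rewrite -{2}r0 -{2}r0' asymptotic_contract//; exact: (boundary_asymptotic bz).
Qed.

Lemma strainer_flow_lip j t t' p p' :
  mdist (strainer_flow j t p) (strainer_flow j t' p') <= mdist p p' + `|t - t'|.
Proof.
have [r z r0] := ray_fromP catX pX p (bxi j); have [s w s0] := ray_fromP catX pX p (beta j).
rewrite (le_trans (metric_triangle _ (strainer_flow j t' p) _))// addrC lerD//.
  rewrite /strainer_flow; case: ifP => t'0; apply: ray_from_lip => //; first by rewrite oppr_ge0.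
  by move/negbT: t'0; rewrite -ltNge => /ltW.
rewrite /strainer_flow; case: (leP t 0) => t0; case: (leP t' 0) => t'0.
- by rewrite geodesic_rayE ?oppr_ge0// -opprD normrN.
- rewrite (le_trans (metric_triangle _ p _))// -{2}r0 -{3}s0 !geodesic_rayE ?oppr_ge0 ?(ltW t'0)//.
  rewrite subr0 sub0r !normrN (ler0_norm t0) (gtr0_norm t'0) ler0_norm; lra.
- rewrite (le_trans (metric_triangle _ p _))// -{2}s0 -{3}r0 !geodesic_rayE ?oppr_ge0 ?(ltW t0)//.
  rewrite subr0 sub0r opprK (ler0_norm t'0) (gtr0_norm t0) ger0_norm; lra.
- by rewrite geodesic_rayE ?(ltW t0) ?(ltW t'0).
Qed.

(** An almost inverse of the strainer map near p: the flows of all the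
    coordinates one after the other. *)
Definition strainer_flows (t : 'I_n -> R) (p : X) : X :=
  foldr (fun j => strainer_flow j (t j)) p (index_enum 'I_n).

Lemma strainer_flows_busemann i t p :
  `|b i (strainer_flows t p) - b i p - t i| <= 2 * delta * \sum_j `|t j|.
Proof.
have -> : t i = \sum_j (i == j)%:R * t j.
  rewrite (bigD1 i)//= eqxx mul1r big1 ?addr0// => j ji.
  by rewrite eq_sym (negbTE ji) mul0r.
rewrite /strainer_flows; elim: (index_enum 'I_n) => [|j s IH] /=.
  by rewrite !big_nil subrr subr0 normr0 mulr0.
rewrite !big_cons; set q := foldr _ _ _ in IH *.
have h := strainer_flow_busemann i j (t j) q.
rewrite [leLHS](_ : _ = `|(b i (strainer_flow j (t j) q) - b i q - (i == j)%:R * t j)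
   + (b i q - b i p - \sum_(k <- s) (i == k)%:R * t k)|); last by congr `| _ |; ring.
by rewrite (le_trans (ler_normD _ _))// mulrDr lerD.
Qed.

Lemma strainer_flows_lip t t' p p' :
  mdist (strainer_flows t p) (strainer_flows t' p') <= mdist p p' + \sum_j `|t j - t' j|.
Proof.
rewrite /strainer_flows; elim: (index_enum 'I_n) => [|j s IH] /=; first by rewrite big_nil addr0.
rewrite big_cons (le_trans (strainer_flow_lip _ _ _ _ _))//.
by rewrite [leRHS]addrCA [leLHS]addrC lerD2l.
Qed.

Lemma strainer_flows_dist t p : mdist p (strainer_flows t p) <= \sum_j `|t j|.
Proof.
have e : strainer_flows (fun=> 0) p = p.
  by rewrite /strainer_flows; elim: (index_enum 'I_n) => //= j s ->; rewrite strainer_flow0.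
rewrite -{1}e (le_trans (strainer_flows_lip _ _ _ _))// mdistxx add0r.
by apply: ler_sum => j _; rewrite sub0r normrN.
Qed.

(** By convexity b i stays below its common value at the two ends.  For the
    lower bound let zp and zn be the ends of the line, on the side of l L and
    of l 0.  As b i takes the same value at l 0 and at l L, the angle at l L
    from zn to xi i is at most right.  By strainer_cos the angle from zn to
    eta i has cosine at most delta, so that the Busemann function of eta i
    grows by at most delta * L from l 0 to l L.  Hence the angle at l 0 from zp
    to eta i has cosine at least - delta and, again by strainer_cos, the one
    from zp to xi i has cosine at most 2 * delta; this bounds the decrease of
    b i. *)
Lemma strainer_segment (l : R -> X) L s i : geodesic_line l -> 0 < L -> 0 <= s <= L ->
  b i (l L) = b i (l 0) -> `|b i (l s) - b i (l 0)| <= 2 * delta * L.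
Proof.
move=> ll L0 sL e; have /andP[s0 s1] := sL; have d0 := ltW delta0.
have rl := geodesic_line_ray ll; have bz := endpoint_boundary rl; have zl := endpoint_self rl.
set zp := endpoint _ in bz zl.
have rm := geodesic_line_ray (geodesic_line_rev ll); have bm := endpoint_boundary rm.
have zm := endpoint_self rm; set zn := endpoint _ in bm zm.
have zv : zn (fun u => l (L - u)).
  apply: (boundary_mem bm zm); first exact: geodesic_line_ray (geodesic_line_rev (geodesic_line_shift L ll)).
  by exists `|L| => u u0; rewrite ll (_ : - u - (L - u) = - L) ?normrN//; ring.
have [h rh hE] := beta i.
have v1 := busemann_angle_ge catX pX (rg i) bm zv (ltW L0).
have v2 := busemann_angle_ge catX pX rh bm zv (ltW L0).
have v3 := busemann_angle_ge catX pX rh bz zl (ltW L0).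
have v4 := busemann_angle_ge catX pX (rg i) bz zl s0.
rewrite !subrr !subr0 hE in v1 v2 v3 v4; rewrite -/(b i) -/(xi i) in v1 v4.
have c1 := strainer_cos (l L) i bm; have c2 := strainer_cos (l 0) i bz.
have m1 := ler_wpM2l (ltW L0) c1; have m2 := ler_wpM2l (ltW L0) c2.
rewrite !mulrDr in m1 m2.
rewrite ler_norml; apply/andP; split.
  have cb : L * cos (angle_at (l 0) (xi i) zp) <= 2 * delta * L by rewrite e in v1; lra.
  set C := cos _ in cb v4.
  have [C0|C0] := leP 0 C.
    by have := ler_wpM2r C0 s1; lra.
  have : s * C <= 0 by rewrite mulr_ge0_le0// ltW.
  by have := mulr_ge0 d0 (ltW L0); lra.
have l01 : 0 <= s / L <= 1 by apply: ratio_itv.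
have := busemann_convex catX (rg i) (geodesic_ray_itv (a := L) rl) (ltW L0) l01.
rewrite divfK ?gt_eqF// -/(b i) e.
have -> : (1 - s / L) * b i (l 0) + s / L * b i (l 0) = b i (l 0) by ring.
by have := mulr_ge0 d0 (ltW L0); lra.
Qed.

End Strainer.

(** * Cubes and covering dimension *)

Section Dimension.
Context {R : realType} {X : metricType R}.

Lemma lebesgue_number (A : set X) (V : set (set X)) : compact A -> open_cover V ->
  exists2 e : R, 0 < e & forall x, A x -> exists2 v, V v & forall y, mdist x y < e -> v y.
Proof.
move=> cA [Vo Vc]; apply: contrapT => no.
have bad (m : nat) : exists x, A x /\ forall v, V v -> exists2 y, mdist x y < m.+1%:R^-1 & ~ v y.
  apply: contrapT => nb; apply: no; exists m.+1%:R^-1; first by rewrite invr_gt0.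
  move=> x Ax; apply: contrapT => nv; apply: nb; exists x; split=> // v Vv.
  apply: contrapT => ny; apply: nv; exists v => // y xy; apply: contrapT => nvy.
  by apply: ny; exists y.
have [u uP] := choice bad.
have [|x [Ax cl]] := cA (u @ \oo) _.
  by exists 0%N => // m _; apply: (uP m).1.
have [v Vv vx] : (\bigcup_(u in V) u) x by rewrite Vc.
have /open_mdistP/(_ x vx)[r r0 rv] := Vo v Vv.
have r20 : 0 < r / 2 by rewrite divr_gt0.
pose M := Num.truncn (r / 2)^-1.
have [y [[m Mm <-] /= xm]] : [set u m | m in [set m | (M <= m)%N]] `&` [set z | mdist x z < r / 2] !=set0.
  apply: cl; first by exists M => // m Mm; exists m.
  by rewrite -metricType_numDomainType.nbhs_nbhs_mdist; exists (r / 2).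
have [w ym nvw] := (uP m).2 v Vv; apply: nvw; apply: rv.
rewrite (le_lt_trans (metric_triangle _ (u m) _))// [ltRHS]splitr ltrD//.
rewrite (lt_le_trans ym)// -[leRHS]invrK lef_pV2 ?posrE ?invr_gt0//.
by rewrite ltW// -truncn_lt_nat ?ltnS ?invr_ge0 ?(ltW r20).
Qed.

(** Lebesgue's covering argument.  The functions f i define an open cover U no
    member of which meets the images of two opposite faces.  Let V be an open
    refinement; every point of a fine grid in the cube is labelled with a
    member of V that contains a ball of a fixed radius around its image.  The
    colour of a grid point is the first i such that its label is not used in
    the face u i = 0.  This satisfies the boundary conditions of
    cubical_sperner, so a unit cube of the grid shows all N + 1 colours; as
    the colour depends on the label only, N + 1 members of V contain the image
    of a corner of the unit cube. *)
Lemma cube_dimension (N : nat) (Sig : ('I_N -> R) -> X) (C a : R) (f : 'I_N -> X -> R) :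
  proper_space X -> covering_dim_lt X N -> 0 < a -> 0 <= C ->
  (forall i x y, f i x - f i y <= mdist x y) ->
  (forall u v, (forall i, 0 <= u i <= 1) -> (forall i, 0 <= v i <= 1) ->
     mdist (Sig u) (Sig v) <= C * \sum_i `|u i - v i|) ->
  (forall u i, (forall j, 0 <= u j <= 1) -> u i = 0 -> f i (Sig u) <= - a) ->
  (forall u i, (forall j, 0 <= u j <= 1) -> u i = 1 -> a <= f i (Sig u)) -> False.
Proof.
move=> pX dimX a0 C0 flip Slip f0 f1.
pose O (s : {ffun 'I_N -> bool}) := [set z | forall i, if s i then f i z < a else - a < f i z].
have Oopen s : open (O s).
  rewrite openE => z zO; apply: filter_forall => i.
  have [e e0 eP] : exists2 e : R, 0 < e & forall y, mdist z y < e -> if s i then f i y < a else - a < f i y.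
    have := zO i; case: (s i) => fz.
      exists (a - f i z); first by rewrite subr_gt0.
      by move=> y zy; have := flip i y z; rewrite metric_sym; lra.
    exists (f i z + a); first lra.
    by move=> y zy; have := flip i z y; lra.
  by apply/metricType_numDomainType.nbhs_mdistP; exists e.
have Ucov : open_cover (range O).
  split; first by move=> _ [s _ <-]; exact: Oopen.
  apply/seteqP; split=> // z _; exists (O [ffun i => f i z < a]); first by exists [ffun i => f i z < a].
  by move=> i; rewrite ffunE; case: ltP => // h; lra.
have [V [Vcov Vref Vmult]] := dimX _ Ucov.
have Vsep v i x y : V v -> v x -> v y -> f i x <= - a -> a <= f i y -> False.
  move=> Vv vx vy fx fy; have [_ [s _ <-] sub] := Vref _ Vv.
  by have := sub _ vx i; have := sub _ vy i; case: (s i) => h1 h2; lra.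
pose x0 := Sig (fun=> 0).
have cube0 (i : 'I_N) : 0 <= (0 : R) <= 1 by rewrite lexx ler01.
have inA u : (forall i, 0 <= u i <= 1) -> mdist x0 (Sig u) <= C * N%:R.
  move=> u01; rewrite (le_trans (Slip _ _ cube0 u01))// ler_wpM2l//.
  rewrite -[N in leRHS]card_ord -sumr_const; apply: ler_sum => i _.
  by rewrite sub0r normrN ger0_norm; case/andP: (u01 i).
have [e e0 eP] := lebesgue_number (@compact_mdist_le _ _ x0 (C * N%:R) pX) Vcov.
(* the mesh of the grid is 1 / k *)
pose k := (Num.truncn (C * N%:R / e)).+1.
have kR0 : (0 : R) < k%:R by rewrite ltr0n.
have mesh : C * N%:R / k%:R < e.
  rewrite ltr_pdivrMr// [ltRHS]mulrC -ltr_pdivrMr// -truncn_lt_nat ?ltnSn//.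
  by rewrite divr_ge0 ?mulr_ge0// ltW.
pose pt (v : {ffun 'I_N -> nat}) (i : 'I_N) : R := Num.min 1 ((v i)%:R / k%:R).
have pt01 v i : 0 <= pt v i <= 1.
  by rewrite le_min ler01 divr_ge0//= ge_min lexx.
have member (v : {ffun 'I_N -> nat}) : exists w, V w /\ forall y, mdist (Sig (pt v)) y < e -> w y.
  by have [w Vw wP] := eP _ (inA _ (pt01 v)); exists w.
have [lab labP] := choice member.
have labself v : lab v (Sig (pt v)) by apply: (labP v).2; rewrite mdistxx.
pose P (w : set X) (i : 'I_N) := ~~ `[< exists v : {ffun 'I_N -> nat}, v i = 0%N /\ lab v = w >].
pose colw w := find (P w) (enum 'I_N).
pose col v := colw (lab v).
have sz : size (enum 'I_N) = N by rewrite size_enum_ord.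
have colN v : (col v <= N)%N by rewrite -[leqRHS]sz find_size.
have col0 (v : {ffun 'I_N -> nat}) (i : 'I_N) : v i = 0%N -> col v != i.
  move=> vi; apply/eqP => ci.
  have hs : has (P (lab v)) (enum 'I_N) by rewrite has_find sz -/(colw _) -/(col v) ci.
  have := nth_find i hs; rewrite -/(colw _) -/(col v) ci nth_ord_enum => /negP; apply.
  by apply/asboolP; exists v.
have colk (v : {ffun 'I_N -> nat}) (i : 'I_N) : v i = k -> (col v <= i)%N.
  move=> vi; rewrite leqNgt; apply/negP => ic.
  have := @before_find _ i (P (lab v)) (enum 'I_N) i ic.
  rewrite nth_ord_enum => /negbFE /asboolP[v' [v'i lv]].
  apply: (Vsep (lab v) i (Sig (pt v')) (Sig (pt v))) => //.
  - exact: (labP v).1.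
  - by rewrite -lv.
  - by apply: f0 => //; rewrite /pt v'i mul0r min_r.
  - by apply: f1 => //; rewrite /pt vi divff ?gt_eqF// minxx.
have [z [zk zcol]] := cubical_sperner (ltn0Sn _ : (0 < k)%N) colN col0 colk.
have vertex c : exists u : {ffun 'I_N -> bool}, (c <= N)%N -> col [ffun i => z i + u i]%N = c.
  have [cN|_] := leqP c N; last by exists [ffun=> false].
  by have [u uc] := zcol c cN; exists u.
have [u uP] := choice vertex.
pose w c := lab [ffun i => z i + u c i]%N.
have wV c : V (w c) by exact: (labP _).1.
have wz c : w c (Sig (pt z)).
  apply: (labP _).2; apply: le_lt_trans mesh.
  rewrite (le_trans (Slip _ _ (pt01 _) (pt01 _)))// -mulrA ler_wpM2l//.
  have -> : N%:R / k%:R = \sum_(i < N) k%:R^-1 :> R.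
    by rewrite sumr_const card_ord mulr_natl.
  apply: ler_sum => i _; rewrite /pt ffunE natrD mulrDl.
  have zk1 : (z i)%:R / k%:R <= 1 :> R by rewrite ler_pdivrMr// mul1r ler_nat ltnW.
  have zk2 : (z i)%:R / k%:R + k%:R^-1 <= 1 :> R.
    by rewrite -[X in _ + X]mul1r -mulrDl ler_pdivrMr// mul1r natr1 ler_nat.
  have k0 : 0 <= k%:R^-1 :> R by rewrite invr_ge0 ltW.
  rewrite (min_r zk1); case: (u c i); rewrite /= ?mul1r ?mul0r ?addr0.
    by rewrite (min_r zk2) addrC addKr ger0_norm.
  by rewrite (min_r zk1) subrr normr0.
have winj : {in `I_N.+1 &, injective w}.
  move=> c c'; rewrite !inE /= !ltnS => cN c'N ww.
  by rewrite -(uP c cN) -(uP c' c'N) /col -/(w c) -/(w c') ww.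
have sub : w @` `I_N.+1 `<=` [set v | V v /\ v (Sig (pt z))].
  by move=> _ [c _ <-]; split; [exact: wV|exact: wz].
have := card_le_trans (subset_card_le sub) (Vmult (Sig (pt z))).
by rewrite (card_le_eql (inj_card_eq winj)) card_le_II ltnn.
Qed.

End Dimension.

(** * Strainer maps in top dimension *)

Section Lipschitz.
Context {R : realType}.

Lemma lipschitz_continuous (X Y : metricType R) (f : X -> Y) (K : R) :
  (forall x y, mdist (f x) (f y) <= K * mdist x y) -> continuous f.
Proof.
move=> fK x; apply/metricType_numDomainType.cvgrPdist_lt => e e0.
have K0 : 0 < `|K| + 1 by rewrite ltr_wpDl.
apply/metricType_numDomainType.nbhs_mdistP; exists (e / (`|K| + 1)) => /=; first by rewrite divr_gt0.
move=> y /=; rewrite ltr_pdivlMr// => xy; apply: le_lt_trans (fK x y) _.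
apply: le_lt_trans xy; rewrite mulrC ler_wpM2l ?mdist_ge0//.
by have := ler_norm K; lra.
Qed.

Lemma lipschitz_real_continuous (X : metricType R) (f : X -> R) (K : R) :
  (forall x y, f x - f y <= K * mdist x y) -> continuous f.
Proof.
move=> fK x; apply/cvgrPdist_lt => e e0.
have K0 : 0 < `|K| + 1 by rewrite ltr_wpDl.
apply/metricType_numDomainType.nbhs_mdistP; exists (e / (`|K| + 1)) => /=; first by rewrite divr_gt0.
move=> y /=; rewrite ltr_pdivlMr// => xy.
have h1 := fK x y; have h2 := fK y x; rewrite (metric_sym y) in h2.
have h3 : K * mdist x y <= mdist x y * (`|K| + 1).
  by rewrite mulrC ler_wpM2l ?mdist_ge0//; have := ler_norm K; lra.
by rewrite ltr_norml; lra.
Qed.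

Lemma sqr_sum_norm_le (n : nat) (a : 'I_n -> R) :
  (\sum_i `|a i|) ^+ 2 <= n%:R * \sum_i a i ^+ 2.
Proof.
have [n0|n0] := posnP n.
  by subst n; rewrite !big_ord0 expr0n mulr0.
set S := \sum_i `|a i|; set A := \sum_i a i ^+ 2.
have nR : (0 : R) < n%:R by rewrite ltr0n.
have : 0 <= \sum_i (n%:R * `|a i| - S) ^+ 2 by apply: sumr_ge0 => i _; apply: sqr_ge0.
have -> : \sum_i (n%:R * `|a i| - S) ^+ 2 = n%:R * (n%:R * A - S ^+ 2).
  have sqrE i : (n%:R * `|a i| - S) ^+ 2 =
      n%:R ^+ 2 * a i ^+ 2 - 2 * n%:R * S * `|a i| + S ^+ 2.
    by rewrite -(real_normK (num_real (a i))); ring.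
  under eq_bigr do rewrite sqrE.
  rewrite big_split sumrB/= -!mulr_sumr -/A -/S sumr_const card_ord -mulr_natl; ring.
by rewrite pmulr_rge0// subr_ge0.
Qed.

End Lipschitz.

Section StrainerMap.
Context {R : realType} {X : metricType R} {n : nat}.
Hypotheses (pX : proper_space X) (gcX : geodesically_complete X) (catX : CAT0 X).
Variables (delta : R) (g : 'I_n -> R -> X) (eta : 'I_n -> set (R -> X)).
Hypothesis delta0 : 0 < delta.
Hypothesis ndelta : 100 * n%:R * delta < 1.
Hypothesis rg : forall j, geodesic_ray (g j).
Hypothesis beta : forall j, ideal_boundary (eta j).
Hypothesis opp : forall j, opposite_spherical delta (endpoint (g j)) (eta j).
Hypothesis orth : forall j k, j != k ->
  angle (endpoint (g j)) (endpoint (g k)) < pi / 2 + delta /\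
  angle (endpoint (g j)) (eta k) < pi / 2 + delta.

Let b j := busemann (g j).
Let flows := strainer_flows g eta.

(** Minimize Phi z = mdist x z + 2 * S z, where S z is the distance of the
    coordinates of z from v in the sum norm.  If S z were positive, moving z by
    the flows with parameters v i - b i z would cost at most S z in the first
    term and reduce the second one to at most 4 * n * delta * S z, which is
    less than S z.  So the minimum is a solution, and Phi z <= Phi x is the
    distance estimate. *)
Lemma strainer_surjective (x : X) (v : 'I_n -> R) :
  exists2 z, forall i, b i z = v i & mdist x z <= 2 * \sum_i `|b i x - v i|.
Proof.
pose Phi z := mdist x z + 2 * \sum_i `|b i z - v i|.
have Philip y z : Phi y - Phi z <= (1 + 2 * n%:R) * mdist y z.
  have h1 := metric_triangle x z y; rewrite (metric_sym z y) in h1.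
  have h2 : \sum_i `|b i y - v i| <= \sum_i `|b i z - v i| + n%:R * mdist y z.
    rewrite -[n in n%:R]card_ord mulr_natl -sumr_const -big_split /=.
    apply: ler_sum => i _.
    rewrite [leLHS](_ : _ = `|(b i z - v i) + (b i y - b i z)|); last by congr `| _ |; ring.
    rewrite (le_trans (ler_normD _ _))// lerD2l ler_norml.
    have := busemann_lip y z (rg i); have := busemann_lip z y (rg i).
    by rewrite (metric_sym z) -/(b i); lra.
  by rewrite /Phi; lra.
have Phix : Phi x = 2 * \sum_i `|b i x - v i| by rewrite /Phi mdistxx add0r.
have [||z zA zmin] := @compact_EVT_min _ _ Phi [set z | mdist x z <= Phi x] _ (@compact_mdist_le _ _ x (Phi x) pX).
- by exists x; rewrite /= mdistxx Phix mulr_ge0// sumr_ge0.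
- by apply: continuous_subspaceT; exact: lipschitz_real_continuous Philip.
have zle w : Phi z <= Phi w.
  have [xw|xw] := leP (mdist x w) (Phi x); first by apply: zmin; rewrite inE.
  have zx : Phi z <= Phi x.
    by apply: zmin; rewrite inE /= mdistxx Phix mulr_ge0// sumr_ge0.
  apply: (le_trans zx); apply: (le_trans (ltW xw)).
  by rewrite /Phi lerDl mulr_ge0// sumr_ge0.
exists z; last first.
  rewrite -Phix; apply: le_trans (zle x).
  by rewrite /Phi lerDl mulr_ge0// sumr_ge0.
pose t i := v i - b i z; pose S := \sum_i `|t i|.
have S0 : 0 <= S by apply: sumr_ge0.
have PhizE : Phi z = mdist x z + 2 * S.
  by rewrite /Phi /S; congr (_ + 2 * _); apply: eq_bigr => i _; rewrite distrC.
have Phiw : Phi (flows t z) <= mdist x z + S + 2 * (n%:R * (2 * delta * S)).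
  rewrite /Phi lerD//.
    rewrite (le_trans (metric_triangle _ z _))// lerD2l.
    exact: strainer_flows_dist.
  rewrite ler_wpM2l// -[n in n%:R]card_ord mulr_natl -sumr_const.
  apply: ler_sum => i _.
  have := strainer_flows_busemann pX gcX catX delta0 rg beta opp orth i t z.
  by rewrite /t opprB addrA subrK.
have Sz : S = 0.
  apply/eqP; rewrite eq_le S0 andbT.
  have := le_trans (zle _) Phiw; rewrite PhizE.
  have -> : n%:R * (2 * delta * S) = n%:R * delta * S * 2 by ring.
  have : n%:R * delta * S <= 1 / 100 * S by have nd := ndelta; rewrite ler_wpM2r//; lra.
  by lra.
move=> i; have := psumr_eq0P (fun i _ => normr_ge0 (t i)) Sz.
by move=> /(_ i isT)/eqP; rewrite normr_eq0 subr_eq0 => /eqP.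
Qed.

Hypothesis dimX : covering_dim_lt X n.+1.

(** Let x and y be different points with the same coordinates, joined by a
    geodesic of length L.  Moving the points of the geodesic by the flows with
    all parameters in [-T, T] gives a cube of dimension n + 1.  The coordinates
    b j separate the opposite faces of the last n directions, because they
    hardly vary on the geodesic; the distance from x separates the two
    remaining faces, since T is so small that these stay within L / 4 of x and
    of y.  This contradicts cube_dimension. *)
Lemma strainer_injective (x y : X) : (forall i, b i x = b i y) -> x = y.
Proof.
move=> bxy; apply/eqP/negPn/negP => xy.
have [l [ll l0 lL]] := extend_segment catX gcX xy.
set L := mdist x y in lL; have L0 : 0 < L by rewrite mdist_gt0.
(* T is small enough for n * T <= L / 4, and large compared with delta * L *)
pose T := L / (4 * n.+1%:R).
have n1 : (0 : R) < n.+1%:R by rewrite ltr0n.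
have nS : n.+1%:R = n%:R + 1 :> R by rewrite -natr1.
have T0 : 0 < T by rewrite divr_gt0// mulr_gt0.
have LT : L = 4 * (n%:R * T) + 4 * T.
  have -> : 4 * (n%:R * T) + 4 * T = T * (4 * n.+1%:R) by rewrite nS; ring.
  by rewrite /T divfK// gt_eqF// mulr_gt0.
have nT0 : 0 <= n%:R * T by rewrite mulr_ge0// ltW.
pose a := T / 5.
pose tt (u : 'I_n.+1 -> R) (j : 'I_n) := T * (2 * u (lift ord0 j) - 1).
pose Sig (u : 'I_n.+1 -> R) := flows (tt u) (l (L * u ord0)).
pose f (i : 'I_n.+1) z := if unlift ord0 i is Some j then b j z - b j x else mdist x z - L / 2.
have ttT u : (forall i, 0 <= u i <= 1) -> \sum_j `|tt u j| <= n%:R * T.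
  move=> u01; rewrite -[n in n%:R]card_ord mulr_natl -sumr_const; apply: ler_sum => j _.
  rewrite /tt normrM (gtr0_norm T0) -[leRHS]mulr1 ler_wpM2l ?(ltW T0)// ler_norml.
  by have := u01 (lift ord0 j); lra.
have Sdist u : (forall i, 0 <= u i <= 1) -> mdist (l (L * u ord0)) (Sig u) <= n%:R * T.
  by move=> u01; rewrite (le_trans (strainer_flows_dist pX catX rg beta _ _))// ttT.
have Sbus u j : (forall i, 0 <= u i <= 1) -> `|b j (Sig u) - b j x - tt u j| <= 4 / 5 * T.
  move=> u01.
  have n0 : (1 : R) <= n%:R by rewrite ler1n; case: (n) j => // -[].
  have h1 := strainer_flows_busemann pX gcX catX delta0 rg beta opp orth j (tt u) (l (L * u ord0)).
  have e : b j (l L) = b j (l 0) by rewrite l0 lL bxy.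
  have uL : 0 <= L * u ord0 <= L.
    have /andP[u0 u1] := u01 ord0; rewrite mulr_ge0 ?(ltW L0)//=.
    by rewrite -[leRHS]mulr1 ler_wpM2l ?(ltW L0).
  have h2 := strainer_segment pX gcX catX delta0 rg beta opp ll L0 uL e.
  rewrite l0 in h2.
  have h3 : 2 * delta * \sum_j `|tt u j| <= 2 * delta * (n%:R * T).
    by rewrite ler_wpM2l ?ttT// mulr_ge0// ltW.
  have h4 : n%:R * delta * T <= 1 / 100 * T by have nd := ndelta; rewrite ler_wpM2r ?(ltW T0)//; lra.
  have h5 : delta * T <= n%:R * delta * T.
    by rewrite ler_wpM2r ?(ltW T0)// ler_peMl// ltW.
  have h6 : delta * L = 4 * (n%:R * delta * T) + 4 * (delta * T) by rewrite LT; ring.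
  rewrite -/(b j) -/flows -/(Sig u) in h1 h2.
  rewrite [leLHS](_ : _ = `|(b j (Sig u) - b j (l (L * u ord0)) - tt u j) + (b j (l (L * u ord0)) - b j x)|);
    last by congr `| _ |; ring.
  apply: (le_trans (ler_normD _ _)).
  have h7 : 2 * delta * (n%:R * T) = 2 * (n%:R * delta * T) by ring.
  by lra.
apply: (@cube_dimension R X n.+1 Sig (L + 2 * T) a f pX dimX).
- by rewrite /a divr_gt0.
- by rewrite addr_ge0 ?mulr_ge0 ?(ltW L0) ?(ltW T0).
- move=> i p q; rewrite /f; case: (unlift ord0 i) => [j|].
    by have := busemann_lip p q (rg j); rewrite -/(b j); lra.
  by have := metric_triangle x q p; rewrite (metric_sym q); lra.
- move=> u v u01 v01; rewrite (le_trans (strainer_flows_lip pX catX rg beta _ _ _ _))//.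
  rewrite ll -mulrBr normrM (gtr0_norm L0) big_ord_recl mulrDr lerD//.
    by rewrite ler_wpM2r// lerDl mulr_ge0// ltW.
  rewrite mulr_sumr; apply: ler_sum => j _.
  rewrite /tt -mulrBr normrM (gtr0_norm T0).
  rewrite (_ : _ - _ - _ = 2 * (u (lift ord0 j) - v (lift ord0 j))); last by ring.
  rewrite normrM (ger0_norm (x := 2))// mulrA ler_wpM2r//; lra.
- move=> u i u01 ui; have D := Sdist u u01; rewrite /f /a.
  case: unliftP ui => [j ->|->] ui.
    have := Sbus u j u01; rewrite /tt ui ler_norml; lra.
  by rewrite ui mulr0 l0 in D; lra.
- move=> u i u01 ui; have D := Sdist u u01; rewrite /f /a.
  case: unliftP ui => [j ->|->] ui.
    have := Sbus u j u01; rewrite /tt ui ler_norml; lra.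
  rewrite ui mulr1 lL in D.
  have := metric_triangle x (Sig u) y; rewrite -/L (metric_sym _ y); lra.
Qed.

End StrainerMap.

Theorem proposition5p9 (R : realType) (X : metricType R) (n : nat) (delta : R)
    (F : X -> euclidean R n) :
  proper_space X -> geodesically_complete X -> CAT0 X -> covering_dim X n ->
  0 < delta -> busemann_strainer_map delta F -> 100 * n%:R * delta < 1 ->
  bilipschitz (2 * Num.sqrt (n%:R : R)) F /\ homeomorphism F.
Proof.
move=> pX gcX catX [dimX ndimX] delta0 [g [rg FE [_ [eta [beta opp orth]]]]] ndelta.
have orth' j k : j != k ->
    angle (endpoint (g j)) (endpoint (g k)) < pi / 2 + delta /\
    angle (endpoint (g j)) (eta k) < pi / 2 + delta.
  by move=> /orth[].
have surj := strainer_surjective pX gcX catX delta0 ndelta rg beta opp orth'.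
have inj := strainer_injective pX gcX catX delta0 ndelta rg beta opp orth' dimX.
have FEi x i : F x ord0 i = busemann (g i) x by rewrite FE mxE.
have Fd x y : mdist (F x) (F y) = Num.sqrt (\sum_i (busemann (g i) x - busemann (g i) y) ^+ 2).
  by rewrite euclidean_mdistE; congr Num.sqrt; apply: eq_bigr => i _; rewrite !FEi.
have c0 : 0 <= 2 * Num.sqrt (n%:R : R) by rewrite mulr_ge0// sqrtr_ge0.
have bil : bilipschitz (2 * Num.sqrt (n%:R : R)) F.
  move=> x y; split.
    apply: (@le_trans _ _ (Num.sqrt n%:R * mdist x y)); last first.
      by rewrite ler_wpM2r ?mdist_ge0// ler_peMl ?sqrtr_ge0// ler1n.
    rewrite Fd -[X in _ * X]ger0_norm ?mdist_ge0// -sqrtr_sqr -sqrtrM// ler_wsqrtr//.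
    rewrite -[n in leRHS]card_ord mulr_natl -sumr_const; apply: ler_sum => i _.
    rewrite -real_normK ?num_real// ler_pXn2r ?nnegrE ?mdist_ge0// ler_norml.
    have := busemann_lip x y (rg i); have := busemann_lip y x (rg i).
    by rewrite (metric_sym y); lra.
  have [z zy xz] := surj x (fun i => busemann (g i) y).
  rewrite (inj _ _ zy) in xz; rewrite (le_trans xz)// -mulrA ler_wpM2l// Fd -sqrtrM//.
  rewrite -[leLHS]ger0_norm ?sumr_ge0// -sqrtr_sqr ler_wsqrtr//.
  exact: sqr_sum_norm_le.
split=> //; split; first by apply: lipschitz_continuous => x y; exact: (bil x y).1.
(* the empty space is ruled out by the lower bound on the dimension *)
have [x0 _] : exists x0 : X, True.
  apply: contrapT => noX; apply: ndimX => U oU; exists U; split=> //.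
    by move=> u Uu; exists u.
  by move=> x; case: noX; exists x.
have pre (v : euclidean R n) : exists z, F z = v.
  have [z zv _] := surj x0 (fun i => v ord0 i).
  by exists z; apply/rowP => i; rewrite FEi zv.
have [G FG] := choice pre.
have GF : cancel F G by move=> x; apply: inj => i; rewrite -!FEi FG.
exists G; split=> //.
by apply: lipschitz_continuous => v w; have := (bil (G v) (G w)).2; rewrite !FG; apply.
Qed.
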